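(* Let $s>0$, $p\in(0,\infty)$, $q\in(0,\infty]$, and let $(I,\mathbb A,m)$ be a finite measure space. Assume: (I) $\mathcal W$ and $\mathcal G$ are grids of $I$, both satisfying (G1) and (G2), and $\mathcal A_2$ is a class of $(s,p,u_2)$-atoms for the grid $\mathcal W$ (satisfying (A1)-(A4)), for some $u_2\in[1,\infty]$. (II) $(k_i)_{i\ge 0}$ is a sequence in $\mathbb N$ for which there are $\alpha>0$ and $A,B\in\mathbb R$ with $\alpha i+A\le k_i\le \alpha i+B$ for every $i$. (III) There are $\lambda\in(0,1)$ and $C_0\geq 0$ such that for every $Q\in\mathcal G$ and every $P\in\mathcal W$ with $P\subset Q$ there are an atom $b_{P,Q}\in\mathcal A_2(P)$ and $s_{P,Q}\in\mathbb C$ such that $$h_Q=\sum_k\ \sum_{P\in\mathcal W^k,\,P\subset Q}s_{P,Q}\,b_{P,Q}$$ is a $\mathcal B^s_{p,q}(\mathcal A_2)$-representation of a function $h_Q$, where, if $Q\in\mathcal G^i$, then $s_{P,Q}=0$ for every $P\in\mathcal W^k$ with $k<k_i$, and for every $k\ge k_i$ $$\sum_{P\in\mathcal W^k,\,P\subset Q}|s_{P,Q}|^p\le C_0\,\lambda^{k-k_i}.$$ Let $\mathcal H^k=\bigcup_{Q\in\mathcal G}\{P\subset Q:\ P\in\mathcal W^k,\ s_{P,Q}\ne0\}$. Let $C_1$ be the constant of (G1) for the grid $\mathcal G$, let $M=\max\{\ell\in\mathbb N:\ \ell<\alpha\}+1$, and let $b=(b_n)_{n\in\mathbb Z}$ be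 defined by $b_n=\lambda^{\alpha n}$ if $n>\frac A\alpha-1$ and $b_n=0$ otherwise. Set $K=C_1\,C_0^{1/p}\,\lambda^{-B/p}\,\Theta(p,q,b)\,M^{1/q}$. Then: **A.** For all coefficients $(c_Q)_{Q\in\mathcal G}$ with $\big(\sum_i(\sum_{Q\in\mathcal G^i}|c_Q|^p)^{q/p}\big)^{1/q}<\infty$, the sequence $$N\mapsto\sum_{i\le N}\sum_{Q\in\mathcal G^i}c_Q h_Q$$ converges in $L^p$ to a function in $\mathcal B^s_{p,q}(\mathcal A_2)$ that has a $\mathcal B^s_{p,q}(\mathcal A_2)$-representation $\sum_k\sum_{P\in\mathcal H^k}m_P d_P$, with $d_P\in\mathcal A_2(P)$ and $m_P\ge0$ for every $P$, and $$\Big(\sum_k\big(\sum_{P\in\mathcal H^k}|m_P|^p\big)^{q/p}\Big)^{1/q}\le K\Big(\sum_i\big(\sum_{Q\in\mathcal G^i}|c_Q|^p\big)^{q/p}\Big)^{1/q}.$$ **B.** Suppose in addition that all $s_{P,Q}$ are non-negative real numbers and that $b_{P,Q}>0$ on $P$ for all $P,Q$. Then the representation in A can be chosen so that, moreover, if $m_P\ne0$ and $d_P\ne0$ on $P$, then $P\subset\operatorname{supp}h_Q$ for some $Q\in\mathcal G$ with $c_Q\ne0$ and $s_{P,Q}>0$. If additionally $c_Q\ge0$ for every $Q$, then $m_P\ne0$ also implies $d_P>0$ on $P$. **C.** Let $\mathcal A_1$ be a class of $(s,p,u_1)$-atoms for the grid $\mathcal G$ (satisfying (A1)-(A4)), $u_1\in[1,\infty]$.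 Suppose that, with $\lambda$, $C_0$ and $(k_i)$ fixed, for every $Q\in\mathcal G$ and every atom $a_Q\in\mathcal A_1(Q)$ one can find $s_{P,Q}$ and $b_{P,Q}$ as in (III) such that $h_Q=a_Q$. Then $\mathcal B^s_{p,q}(\mathcal A_1)\subset\mathcal B^s_{p,q}(\mathcal A_2)$ and this inclusion is continuous; indeed, $|\phi|_{\mathcal B^s_{p,q}(\mathcal A_2)}\le K\,|\phi|_{\mathcal B^s_{p,q}(\mathcal A_1)}$ for every $\phi\in\mathcal B^s_{p,q}(\mathcal A_1)$.
   Context: Notation: $|J|=m(J)$; $|\cdot|_p$ is the (quasi-)norm of $L^p=L^p(I,\mathbb A,m)$, $m(I)<\infty$; $\mathbb N=\{0,1,2,\dots\}$; $\hat t=\max\{1,t\}$; $r'$ is defined by $1/r+1/r'=1$ (with $\infty'=1$, $1'=\infty$). Sums with exponent $q=\infty$ are replaced by suprema (and $M^{1/\infty}=1$). $\operatorname{supp}h=\{x:h(x)\ne0\}$; inclusions in supports are up to sets of measure zero. Grid: a sequence $\mathcal P=(\mathcal P^k)_{k\in\mathbb N}$ of finite families of measurable subsets of $I$ of positive measure, at least one family non-empty, such that (G1) $C_1:=\sup_k\sup_{Q\in\mathcal P^k}\#\{P\in\mathcal P^k:P\cap Q\ne\emptyset\}<\infty$. Sets belonging to different levels are assumed distinct, and $\mathcal P$ also denotes $\bigcup_k\mathcal P^k$. Put $|\mathcal P^k|=\sup\{|Q|:Q\in\mathcal P^k\}$. For $t\in(0,\infty)$, $q\in(0,\infty]$ and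 a non-negative sequence $b=(b_k)$ define $\Gamma(t,q,b)$ as: $(\sum_k b_k^{q'/t})^{1/q'}$ if $t\ge1,q>1$; $\sup_k b_k^{1/t}$ if $t\ge1,q\le1$; $(\sum_k b_k^{(q/t)'})^{1/(t(q/t)')}$ if $t<1,q>t$; $\sup_kb_k^{1/t}$ if $t<1,q\le t$. (G2): $\Gamma(p,q,(|\mathcal P^k|^{sp})_k)<\infty$ and $\lim_k|\mathcal P^k|=0$. For a non-negative sequence $b=(b_k)_{k\in\mathbb Z}$ define $\Theta(p,q,b)$ as: $\sum_k b_k^{1/p}$ if $p\ge1,q\ge1$; $(\sum_kb_k^{q/p})^{1/q}$ if $p\ge1,q\le1$; $(\sum_kb_k)^{1/p}$ if $p<1,q\ge p$; $(\sum_kb_k^{q/p})^{1/q}$ if $p<1,q<p$. Class of $(s,p,u)$-atoms for a grid $\mathcal P$ ($u\in[1,\infty]$): an indexed family $\mathcal A=(\mathcal B(Q),\mathcal A(Q))_{Q\in\mathcal P}$ such that (A1) $\mathcal B(Q)$ is a complex Banach space contained in $L^{pu}$; (A2) every $\phi\in\mathcal B(Q)$ vanishes outside $Q$; (A3) $\mathcal A(Q)$ is a non-empty convex subset of $\mathcal B(Q)$, and $\phi\in\mathcal A(Q)$ iff $\sigma\phi\in\mathcal A(Q)$ for every $\sigma\in\mathbb C$ with $|\sigma|=1$; (A4) $|\phi|_{pu}\le|Q|^{s-\frac1{u'p}}$ for every $\phi\in\mathcal A(Q)$. Besov-ish space $\mathcal B^s_{p,q}(\mathcal A)=\mathcal B^s_{p,q}(I,\mathcal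 P,\mathcal A)$: the set of all complex valued $g\in L^p$ that can be written as $g=\sum_{k}\sum_{Q\in\mathcal P^k}s_Qa_Q$ with $a_Q\in\mathcal A(Q)$, $s_Q\in\mathbb C$, the series converging absolutely in $L^p$, meaning $\sum_k|\sum_{Q\in\mathcal P^k}s_Qa_Q|_p^{p/\hat p}<\infty$, and with finite cost $\big(\sum_k(\sum_{Q\in\mathcal P^k}|s_Q|^p)^{q/p}\big)^{1/q}<\infty$. Such a series is a $\mathcal B^s_{p,q}(\mathcal A)$-representation of $g$, and $|g|_{\mathcal B^s_{p,q}(\mathcal A)}$ is the infimum of the costs over all representations. *)

(* Defs.v *)
From HB Require Import structures.
From mathcomp Require Export all_boot all_order all_algebra finmap.
From mathcomp Require Export complex.
From mathcomp Require Export all_classical all_reals all_analysis.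

Set Implicit Arguments.
Unset Strict Implicit.
Unset Printing Implicit Defensive.
Import Order.TTheory GRing.Theory Num.Theory.
Import numFieldNormedType.Exports.

Local Open Scope classical_set_scope.
Local Open Scope ring_scope.

(* Conventions.  Elements of [L^p] are represented by measurable functions
   [T -> R[i]]; every condition on such functions (equality, positivity on a
   set, vanishing outside a set, support) is imposed almost everywhere, and
   sets of functions such as [atoms A Q] are stable under a.e. equality.
   Norms and costs are extended reals; [x `^ 0 = 1] and [0 `^ r = 0] for
   [r != 0].  Exponents such as [1/q] with [q = +oo] are computed in [\bar R]
   and brought back to [R] by [fine], so that [1/+oo = 0]. *)

Section lebesgue_spaces.
Context {d : measure_display} {T : measurableType d} {R : realType}.
Variable m : {measure set T -> \bar R}.

Definition cmeasurable (f : T -> R[i]) : Prop :=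
  measurable_fun setT (fun x => complex.Re (f x)) /\
  measurable_fun setT (fun x => complex.Im (f x)).

(* [normc z] is the modulus of [z], as an element of [R]; for [p < 1] this is
   only a quasi-norm. *)
Definition cnorm (p : \bar R) (f : T -> R[i]) : \bar R :=
  Lnorm m p (fun x => (Normc.normc (f x))%:E).

Definition Lp (p : \bar R) : set (T -> R[i]) :=
  [set f | cmeasurable f /\ (cnorm p f < +oo)%E].

Definition Lp_cvg (p : \bar R) (S : nat -> T -> R[i]) (g : T -> R[i]) : Prop :=
  (fun n => cnorm p (fun x => S n x - g x)) @ \oo --> 0%E.

(* [B] is the set of functions representing the elements of a complex Banach
   space [E] that is linearly embedded in [L^r]; [iota e] is a representative
   of the a.e. class [e], so [iota] is linear and injective only up to a.e.
   equality. *)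
Definition banach_in_Lp (r : \bar R) (B : set (T -> R[i])) : Prop :=
  exists (E : completeNormedModType R[i]) (iota : E -> T -> R[i]),
    [/\ forall e, Lp r (iota e),
        forall (z : R[i]) e e',
          {ae m, forall x, iota (z *: e + e') x = z * iota e x + iota e' x},
        forall e, {ae m, forall x, iota e x = 0} -> e = 0
      & forall f, B f <->
          cmeasurable f /\ exists e, {ae m, forall x, f x = iota e x}].

End lebesgue_spaces.

Section sequences.
Context {R : realType}.

Definition Gamma (t : R) (q : \bar R) (b : nat -> R) : \bar R :=
  (let q' := fine (hoelder_conjugate q) in
   let qt' := fine (hoelder_conjugate (q / t%:E)) in
   if (1 <= t)%R then
     if 1 < q then (\sum_(0 <= k <oo) (b k `^ (q' / t)%R)%:E) `^ q'^-1
     else ereal_sup (range (fun k => (b k `^ t^-1%R)%:E))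
   else
     if t%:E < q then
       (\sum_(0 <= k <oo) (b k `^ qt')%:E) `^ (t * qt')^-1%R
     else ereal_sup (range (fun k => (b k `^ t^-1%R)%:E)))%E.

(* In the second and fourth cases [q] is finite. *)
Definition Theta (p : R) (q : \bar R) (b : int -> R) : \bar R :=
  (if (1 <= p)%R then
     if 1 <= q then \esum_(n in [set: int]) (b n `^ p^-1%R)%:E
     else (\esum_(n in [set: int]) (b n `^ (fine q / p)%R)%:E) `^ (fine q)^-1
   else
     if p%:E <= q then (\esum_(n in [set: int]) (b n)%:E) `^ p^-1
     else (\esum_(n in [set: int]) (b n `^ (fine q / p)%R)%:E) `^ (fine q)^-1)%E.

End sequences.

Section grids.
Context {d : measure_display} {T : measurableType d} {R : realType}.
Variable m : {measure set T -> \bar R}.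
Implicit Types (P F : nat -> set (set T)).

Record is_grid P : Prop := IsGrid {
  grid_finite : forall k, finite_set (P k);
  grid_measurable : forall k Q, P k Q -> measurable Q;
  grid_gt0 : forall k Q, P k Q -> (0 < m Q)%E;
  grid_nonempty : exists k, P k !=set0;
  grid_distinct : forall j k Q, P j Q -> P k Q -> j = k }.

Definition overlap_const P : \bar R :=
  ereal_sup [set y | exists k Q, P k Q /\
    y = (#|` fset_set [set P' | P k P' /\ P' `&` Q !=set0]|)%:R%:E].

Definition G1 P : Prop := (overlap_const P < +oo)%E.

(* [sup set0 = 0]: the mesh of an empty level is [0]. *)
Definition mesh P (k : nat) : R := sup [set fine (m Q) | Q in P k].

Definition G2 (s p : R) (q : \bar R) P : Prop :=
  (Gamma p q (fun k => (mesh P k `^ (s * p))%R) < +oo)%E /\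
  mesh P k @[k --> \oo] --> 0.

End grids.

Section besov.
Context {d : measure_display} {T : measurableType d} {R : realType}.
Variable m : {measure set T -> \bar R}.

Record atom_class := AtomClass {
  atom_space : set T -> set (T -> R[i]);
  atoms : set T -> set (T -> R[i]) }.

Record is_atom_class (P : nat -> set (set T)) (s p : R) (u : \bar R)
    (A : atom_class) : Prop := IsAtomClass {
  atom_A1 : forall k Q, P k Q -> banach_in_Lp m (p%:E * u)%E (atom_space A Q);
  atom_A2 : forall k Q, P k Q -> forall phi, atom_space A Q phi ->
    {ae m, forall x, ~ Q x -> phi x = 0};
  atom_A3_sub : forall k Q, P k Q -> atoms A Q `<=` atom_space A Q;
  atom_A3_nonempty : forall k Q, P k Q -> atoms A Q !=set0;
  atom_A3_ae : forall k Q, P k Q -> forall phi psi, atoms A Q phi ->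
    cmeasurable psi -> {ae m, forall x, phi x = psi x} -> atoms A Q psi;
  atom_A3_convex : forall k Q, P k Q -> forall phi psi (t : R),
    atoms A Q phi -> atoms A Q psi -> 0 <= t <= 1 ->
    atoms A Q (fun x => t%:C%C * phi x + (1 - t)%:C%C * psi x);
  atom_A3_circled : forall k Q, P k Q -> forall (z : R[i]) phi,
    `|z| = 1 -> atoms A Q phi <-> atoms A Q (fun x => z * phi x);
  atom_A4 : forall k Q, P k Q -> forall phi, atoms A Q phi ->
    (cnorm m (p%:E * u) phi <=
     m Q `^ (s - fine (hoelder_conjugate u * p%:E)^-1)%R)%E }.

(* Below, [F] is a grid or a subfamily of a grid, such as the
   [P \in W^k] contained in a given set; the sums then run over [F k]. *)

Definition level_sum (F : nat -> set (set T)) (c : set T -> R[i])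
    (a : set T -> T -> R[i]) (k : nat) (x : T) : R[i] :=
  \sum_(Q \in F k) c Q * a Q x.

Definition level_coef (F : nat -> set (set T)) (p : R) (c : set T -> R[i])
    (k : nat) : R :=
  \sum_(Q \in F k) Normc.normc (c Q) `^ p.

Definition cost (F : nat -> set (set T)) (p : R) (q : \bar R)
    (c : set T -> R[i]) : \bar R :=
  (if q is r%:E then
     (\sum_(0 <= k <oo) (level_coef F p c k `^ (r / p)%R)%:E) `^ r^-1
   else ereal_sup (range (fun k => (level_coef F p c k `^ p^-1%R)%:E)))%E.

Record is_representation (p : R) (q : \bar R) (A : atom_class)
    (F : nat -> set (set T)) (c : set T -> R[i]) (a : set T -> T -> R[i])
    (g : T -> R[i]) : Prop := IsRepresentation {
  rep_Lp : Lp m p%:E g;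
  rep_atoms : forall k Q, F k Q -> atoms A Q (a Q);
  rep_abs : (\sum_(0 <= k <oo)
    cnorm m p%:E (level_sum F c a k) `^ (p / Num.max 1 p)%R < +oo)%E;
  rep_cost : (cost F p q c < +oo)%E;
  rep_cvg : Lp_cvg m p%:E (fun N x => \sum_(k < N) level_sum F c a k x) g }.

Definition besov (p : R) (q : \bar R) (P : nat -> set (set T))
    (A : atom_class) : set (T -> R[i]) :=
  [set g | exists c a, is_representation p q A P c a g].

Definition besov_norm (p : R) (q : \bar R) (P : nat -> set (set T))
    (A : atom_class) (g : T -> R[i]) : \bar R :=
  ereal_inf [set y | exists c a,
    is_representation p q A P c a g /\ y = cost P p q c].

End besov.

Section transmutation.
Context {d : measure_display} {T : measurableType d} {R : realType}.
Variable m : {measure set T -> \bar R}.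

(* The elements of the grid [W] contained in [Q]. *)
Definition inside (W : nat -> set (set T)) (Q : set T) (k : nat) :
    set (set T) :=
  [set P | W k P /\ P `<=` Q].

(* The condition on the expansion of [h], for one [Q] in the level [i] of the
   grid: [sigma P] and [beta P] stand for [s_{P,Q}] and [b_{P,Q}]. *)
Definition transmutes (p : R) (q : \bar R) (W : nat -> set (set T))
    (A2 : @atom_class d T R) (kk : nat -> nat) (lambda C0 : R)
    (i : nat) (Q : set T) (sigma : set T -> R[i]) (beta : set T -> T -> R[i])
    (h : T -> R[i]) : Prop :=
  [/\ is_representation m p q A2 (inside W Q) sigma beta h,
      forall k P, inside W Q k P -> (k < kk i)%N -> sigma P = 0
    & forall k, (kk i <= k)%N ->
        level_coef (inside W Q) p sigma k <= C0 * lambda ^+ (k - kk i)].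

(* The families [H^k]. *)
Definition used (G W : nat -> set (set T)) (s : set T -> set T -> R[i])
    (k : nat) : set (set T) :=
  [set P | exists i Q, [/\ G i Q, inside W Q k P & s P Q != 0]].

(* [sup] is here the maximum of a finite non-empty set of natural numbers. *)
Definition Mconst (alpha : R) : R :=
  sup [set l%:R | l in [set l : nat | l%:R < alpha]] + 1.

Definition bseq (lambda alpha A : R) (n : int) : R :=
  if A / alpha - 1 < n%:~R then lambda `^ (alpha * n%:~R) else 0.

Definition Kconst (G : nat -> set (set T)) (p : R) (q : \bar R)
    (alpha A B lambda C0 : R) : \bar R :=
  (overlap_const G * (C0 `^ p^-1)%:E * (lambda `^ (- B / p)%R)%:E *
   Theta p q (bseq lambda alpha A) *
   (Mconst alpha `^ fine q^-1)%:E)%E.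

(* [mu] and [delta] stand for the coefficients [m_P] and the atoms [d_P]; in
   [R[i]], [0 <= z] says that [z] is a non-negative real number. *)
Definition transmuted (p : R) (q : \bar R) (G W : nat -> set (set T))
    (A2 : @atom_class d T R) (K : \bar R)
    (s : set T -> set T -> R[i]) (h : set T -> T -> R[i])
    (c : set T -> R[i]) (g : T -> R[i])
    (mu : set T -> R[i]) (delta : set T -> T -> R[i]) : Prop :=
  [/\ Lp_cvg m p%:E
        (fun N x => \sum_(i < N.+1) \sum_(Q \in G i) c Q * h Q x) g,
      besov m p q W A2 g,
      is_representation m p q A2 (used G W s) mu delta g,
      forall k P, used G W s k P -> 0 <= mu P
    & (cost (used G W s) p q mu <= K * cost G p q c)%E].

End transmutation.

(* Main.v *)
(** Insert the expansions of the [h_Q] into [\sum_Q c_Q h_Q] and collect, for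
    every [P], the terms carried by [P]: since [A_2(P)] is convex and circled,
    they add up to [m_P d_P] with [m_P = \sum_Q |c_Q s_{P,Q}|] and [d_P] an atom.
    Write [|m_k|] for the [l^p] norm of [m_P] over [P \in W^k] and [|c_i|] for
    that of [c_Q] over [Q \in G^i].  Bounded overlap and the decay of [s_{P,Q}]
    give, with [r = min(1, p, q)] and [j(k) = floor(k / alpha)],
      [|m_k|^r <= const * \sum_i b_{j(k)-i}^{r/p} |c_i|^r],
    a convolution; Young's inequality in [l^{q/r}] and the fact that [j] has
    fibers of size at most [M] yield the bound on the cost, because
    [Theta(p, q, b) = (\sum_n b_n^{r/p})^{1/r}] in all four cases.  The same
    bounds and (G2) make the double series over [i] and [k] absolutely summable
    in [L^p], so that it may be summed in either order. *)
Require Import Defs.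
From mathcomp Require Import measurable_realfun ess_sup_inf hoelder ring lra.

Set Implicit Arguments.
Unset Strict Implicit.
Unset Printing Implicit Defensive.
Import Order.TTheory GRing.Theory Num.Theory.
Import numFieldNormedType.Exports.

Local Open Scope classical_set_scope.
Local Open Scope ring_scope.

(** * Powers and finite sums *)

Section real_inequalities.
Context {R : realType}.

(** (A3) admits only finite combinations, so the terms carried by one [P] must be finitely many
    before they can be merged into an atom. This is the role of (II): k_i tends to infinity, hence
    only finitely many levels of [G] reach a given level of [W], and every m_P d_P is an explicit
    finite sum, from which the positivity in B is read off. For p < 1 the space L^p is not normed;
    the t-th power of its quasi-norm, t = min(1, p), is subadditive for every p, and completeness,
    uniqueness of limits and the exchange of summations are proved for this power. The cost lives in
    l^q and the convergence in L^p, and (G2) is the pairing between them: it makes the t-th powers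
    of mesh^s times the level norms summable. Finally, limits in L^p are determined only almost
    everywhere, so in C the limit delivered by A still has to be identified with the given
    function. *)

Lemma ler_powR2r (r x y : R) : 0 <= r -> 0 <= x -> x <= y -> x `^ r <= y `^ r.
Proof.
by move=> r0 x0 xy; apply: ge0_ler_powR => //; rewrite nnegrE// (le_trans x0).
Qed.

Lemma powRK (r x : R) : r != 0 -> 0 <= x -> (x `^ r) `^ r^-1 = x.
Proof. by move=> r0 x0; rewrite -powRrM mulfV// powRr1. Qed.

Lemma powRVK (r x : R) : r != 0 -> 0 <= x -> (x `^ r^-1) `^ r = x.
Proof. by move=> r0 x0; rewrite -powRrM mulVf// powRr1. Qed.

(** By homogeneity it reduces to u <= u^r for u in (0, 1], used at u = x / (x + y) and u = y / (x +
    y), whose sum is 1. *)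
Lemma powRD_le (r x y : R) : 0 < r <= 1 -> 0 <= x -> 0 <= y ->
  (x + y) `^ r <= x `^ r + y `^ r.
Proof.
move=> /andP[r0 r1] x0 y0.
have := addr_ge0 x0 y0; rewrite le_eqVlt => /predU1P[<-|S0].
  by rewrite powR0 ?gt_eqF// addr_ge0 ?powR_ge0.
have H z : 0 <= z -> z <= x + y -> z / (x + y) * (x + y) `^ r <= z `^ r.
  rewrite le_eqVlt => /predU1P[<- _|z0 zS]; first by rewrite !mul0r powR_ge0.
  have zS0 : 0 < z / (x + y) by rewrite divr_gt0.
  have : z / (x + y) <= (z / (x + y)) `^ r.
    by apply: ger1_powR => //; rewrite zS0/= ler_pdivrMr// mul1r.
  move=> /(ler_wpM2r (powR_ge0 (x + y) r)) /le_trans; apply.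
  by rewrite -powRM ?(ltW S0) ?(ltW zS0)// divfK// gt_eqF.
apply: le_trans (lerD (H x x0 _) (H y y0 _)); rewrite ?lerDl ?lerDr//.
by rewrite -!mulrDl divff ?mul1r// gt_eqF.
Qed.

Lemma powR_sum_le (I : Type) (s : seq I) (P : pred I) (r : R) (F : I -> R) :
  0 < r <= 1 -> (forall i, P i -> 0 <= F i) ->
  (\sum_(i <- s | P i) F i) `^ r <= \sum_(i <- s | P i) F i `^ r.
Proof.
move=> r01 F0; elim: s => [|i s IH].
  by rewrite !big_nil powR0 ?gt_eqF//; case/andP: r01.
rewrite !big_cons; case: ifPn => // Pi.
apply: le_trans (powRD_le r01 (F0 _ Pi) _) _; first exact: sumr_ge0.
by rewrite lerD2l.
Qed.

(** The graph of a convex power lies above its tangent at [y]. Instead of differentiating, Young's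
    inequality is applied to the product of [x] and y^(rho - 1), with exponents [rho] and
    [rho / (rho - 1)]. *)
Lemma powR_tangent (rho x y : R) : 1 < rho -> 0 <= x -> 0 <= y ->
  rho * (y `^ (rho - 1) * x) - (rho - 1) * y `^ rho <= x `^ rho.
Proof.
move=> rho1 x0 y0; have rho0 : 0 < rho by lra.
have rho10 : 0 < rho - 1 by lra.
have /= := @conjugate_powR R x (y `^ (rho - 1)) rho (rho / (rho - 1)) x0
  (powR_ge0 _ _) rho0 (divr_gt0 rho0 rho10).
have -> : rho^-1 + (rho / (rho - 1))^-1 = 1.
  by rewrite invf_div -[X in X + _]mul1r -mulrDl addrC subrK mulfV// gt_eqF.
move=> /(_ erefl); rewrite -powRrM mulrCA mulfV ?gt_eqF// mulr1 invf_div.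
by rewrite (mulrA (y `^ rho)) -mulrDl ler_pdivlMr// => H; lra.
Qed.

(** The tangent inequality at the weighted mean of [g] is summed against the weights [b]. This is
    Jensen's inequality for weights of arbitrary mass, the source of both Minkowski's and Young's
    inequality below. *)
Lemma jensen_powR (I : Type) (s : seq I) (P : pred I) (rho : R) (b g : I -> R) :
  1 <= rho -> (forall i, P i -> 0 <= b i) -> (forall i, P i -> 0 <= g i) ->
  (\sum_(i <- s | P i) b i * g i) `^ rho <=
  (\sum_(i <- s | P i) b i) `^ (rho - 1) *
  \sum_(i <- s | P i) b i * g i `^ rho.
Proof.
rewrite le_eqVlt => /predU1P[<- b0 g0|rho1 b0 g0].
  rewrite subrr powRr0 mul1r powRr1; last first.
    by rewrite sumr_ge0// => i Pi; rewrite mulr_ge0 ?b0 ?g0.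
  by apply: ler_sum => i Pi; rewrite powRr1 ?g0.
have rho0 : rho != 0 by rewrite gt_eqF// (lt_trans ltr01).
set B := \sum_(i <- s | P i) b i; set S := \sum_(i <- s | P i) b i * g i.
have S0 : 0 <= S by rewrite sumr_ge0// => i Pi; rewrite mulr_ge0 ?b0 ?g0.
have : 0 <= B by exact: sumr_ge0.
rewrite le_eqVlt => /predU1P[B0|B0].
  have -> : S = 0.
    rewrite /S; move: B0; rewrite /B; elim: s {B S S0} => [|i s IH].
      by rewrite !big_nil.
    rewrite !big_cons; case: ifPn => // Pi /eqP; rewrite eq_sym.
    rewrite paddr_eq0 ?b0 ?sumr_ge0// => /andP[/eqP -> /eqP] H.
    by rewrite mul0r add0r IH.
  by rewrite powR0// mulr_ge0 ?powR_ge0// sumr_ge0// => i Pi;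
    rewrite mulr_ge0 ?b0 ?powR_ge0.
set y := S / B; have y0 : 0 <= y by rewrite divr_ge0// ltW.
have : B * y `^ rho <= \sum_(i <- s | P i) b i * g i `^ rho.
  apply: le_trans (ler_sum _ (fun i Pi =>
    ler_wpM2l (b0 i Pi) (powR_tangent rho1 (g0 i Pi) y0))).
  have -> : \sum_(i <- s | P i) b i * (rho * (y `^ (rho - 1) * g i) -
      (rho - 1) * y `^ rho) =
      rho * y `^ (rho - 1) * S - (rho - 1) * y `^ rho * B.
    by rewrite /S /B !mulr_sumr -sumrB; apply: eq_bigr => i _; ring.
  have -> : S = y * B by rewrite /y divfK// gt_eqF.
  by rewrite -(mulr_powRB1 y0 (lt_trans ltr01 rho1)) le_eqVlt; apply/orP; left;
    apply/eqP; ring.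
move=> /(ler_wpM2l (powR_ge0 B (rho - 1))); apply: le_trans.
rewrite mulrA [_ * B]mulrC mulr_powRB1 ?(ltW B0) ?(lt_trans ltr01)//.
by rewrite -powRM ?(ltW B0)// /y mulrCA mulfV ?mulr1// gt_eqF.
Qed.

(** Jensen in [j], with the column norms [n j] as weights and the normalised entries [v i j / n j]
    as values: each normalised column has rho-th power sum at most 1. *)
Lemma minkowski_sum (I : eqType) (J : Type) (s : seq I) (t : seq J) (rho : R)
    (v : I -> J -> R) :
  1 <= rho -> (forall i j, 0 <= v i j) ->
  \sum_(i <- s) (\sum_(j <- t) v i j) `^ rho <=
  (\sum_(j <- t) (\sum_(i <- s) v i j `^ rho) `^ rho^-1) `^ rho.
Proof.
move=> rho1 v0; have rho_gt0 : 0 < rho by rewrite (lt_le_trans ltr01).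
have rho0 : rho != 0 by rewrite gt_eqF.
pose n j := (\sum_(i <- s) v i j `^ rho) `^ rho^-1.
have nE j : n j `^ rho = \sum_(i <- s) v i j `^ rho.
  by rewrite powRVK ?sumr_ge0// => i _; exact: powR_ge0.
have n0 j : 0 <= n j by exact: powR_ge0.
(* A column of norm zero vanishes on [s], so division by zero, which gives zero, does no harm. *)
have vE i j : i \in s -> n j * (v i j / n j) = v i j.
  move=> si; have [nj0|nj0] := eqVneq (n j) 0; last by rewrite mulrCA mulfV ?mulr1.
  have /eqP := nE j; rewrite nj0 powR0// eq_sym psumr_eq0 => [/allP/(_ _ si)|k _].
    by rewrite /= powR_eq0 rho0 andbT => /eqP ->; rewrite mul0r.
  exact: powR_ge0.
have vn0 i j : 0 <= v i j / n j by rewrite divr_ge0.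
rewrite -/(n _); set N := \sum_(j <- t) n j.
have N0 : 0 <= N by rewrite sumr_ge0.
apply: (@le_trans _ _ (\sum_(i <- s)
    N `^ (rho - 1) * \sum_(j <- t) n j * (v i j / n j) `^ rho)).
  rewrite big_seq [leRHS]big_seq; apply: ler_sum => i si.
  by under eq_bigr do rewrite -(vE _ _ si); exact: jensen_powR.
rewrite -mulr_sumr exchange_big/= -(mulr_powRB1 N0 rho_gt0) mulrC.
apply: ler_wpM2r; first exact: powR_ge0.
apply: ler_sum => j _; rewrite -mulr_sumr ler_piMr//.
under eq_bigr do rewrite powRM ?invr_ge0//.
rewrite -mulr_suml -nE -powRM ?invr_ge0//.
have [->|nj0] := eqVneq (n j) 0; first by rewrite mul0r powR0 ?ler01.
by rewrite mulfV// powR1.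
Qed.

(** The exponent is split as p = r (p / r): the inner power [r <= 1] is subadditive and the outer
    power [p / r >= 1] obeys Minkowski. This treats p < 1 and p >= 1 in one way. *)
Lemma quasi_minkowski_sum (I : eqType) (J : Type) (s : seq I) (t : seq J)
    (p r : R) (y : I -> J -> R) (u : J -> R) :
  0 < r <= 1 -> r <= p -> (forall i j, 0 <= y i j) -> (forall j, 0 <= u j) ->
  (forall j, \sum_(i <- s) y i j `^ p <= u j `^ p) ->
  \sum_(i <- s) (\sum_(j <- t) y i j) `^ p <=
  (\sum_(j <- t) u j `^ r) `^ (p / r).
Proof.
move=> r01 rp y0 u0 yu; have /andP[r0 r1] := r01.
have p0 : 0 < p by rewrite (lt_le_trans r0).
have pr0 : 0 <= p / r by rewrite divr_ge0 ?ltW.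
have pr1 : 1 <= p / r by rewrite ler_pdivlMr// mul1r.
have pE x : x `^ p = (x `^ r) `^ (p / r).
  by rewrite -powRrM mulrCA mulfV ?mulr1// gt_eqF.
apply: (@le_trans _ _ (\sum_(i <- s) (\sum_(j <- t) y i j `^ r) `^ (p / r))).
  apply: ler_sum => i _; rewrite pE ler_powR2r ?powR_ge0//.
  exact: powR_sum_le.
apply: le_trans (minkowski_sum _ _ pr1 _) _ => [i j|]; first exact: powR_ge0.
rewrite ler_powR2r ?sumr_ge0// => [j _|]; first exact: powR_ge0.
apply: ler_sum => j _; under eq_bigr do rewrite -pE.
rewrite invf_div -[leRHS](_ : (u j `^ p) `^ (r / p) = _).
  rewrite ler_powR2r ?divr_ge0 ?(ltW r0) ?(ltW p0) ?sumr_ge0// => i _.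
  exact: powR_ge0.
by rewrite -powRrM mulrCA mulfV ?mulr1// gt_eqF.
Qed.

(** Subadditivity suffices for p <= 1, and Jensen with unit weights gives D^(p - 1) otherwise;
    [D >= 1] absorbs both into D^p, which becomes a plain factor [D] once p-th roots are taken. *)
Lemma powR_sum_le_card (I : Type) (s : seq I) (P : pred I) (p D : R)
    (F : I -> R) : 0 < p -> (forall i, P i -> 0 <= F i) ->
  1 <= D -> (count P s)%:R <= D ->
  (\sum_(i <- s | P i) F i) `^ p <= D `^ p * \sum_(i <- s | P i) F i `^ p.
Proof.
move=> p0 F0 D1 sD; have D0 : 0 <= D by rewrite (le_trans ler01).
have S0 : 0 <= \sum_(i <- s | P i) F i `^ p.
  by rewrite sumr_ge0// => i _; exact: powR_ge0.
have [p1|p1] := leP p 1.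
  apply: le_trans (powR_sum_le _ _ F0) _; first by rewrite p0.
  by rewrite ler_peMl//; have := ler_powR2r (ltW p0) ler01 D1; rewrite powR1.
have := @jensen_powR I s P p (fun=> 1) F (ltW p1) (fun=> fun=> ler01) F0.
under eq_bigr do rewrite mul1r; under [X in _ * X]eq_bigr do rewrite mul1r.
move/le_trans; apply; apply: ler_wpM2r => //.
rewrite -sum1_count natr_sum in sD.
apply: (@le_trans _ _ (D `^ (p - 1))).
  by rewrite ler_powR2r ?subr_ge0 ?(ltW p1) ?sumr_ge0.
by rewrite ler_powR// lerBlDl lerDr.
Qed.

End real_inequalities.

(** * Convolutions and the constant [Theta] *)

Section sequences.
Context {R : realType}.

Lemma lee_poweR (r : R) (x y : \bar R) : 0 <= r -> (0 <= x)%E -> (x <= y)%E ->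
  (x `^ r <= y `^ r)%E.
Proof.
move=> r0 x0 xy; apply: gt0_ler_poweR => //; rewrite in_itv/= leey andbT//.
exact: le_trans xy.
Qed.

(** Summability with bound [S], for the non-negative families used here. Stated with finite lists,
    it needs no enumeration of [int] and is visibly invariant under translation and reflection of
    the index. *)
Definition sum_bounded (I : eqType) (b : I -> R) (S : R) :=
  forall U : seq I, uniq U -> \sum_(z <- U) b z <= S.

(** Grouping the indices [k] by the value [phi k] meets each value at most [M] times. *)
Lemma sum_fibers_le (I : eqType) (b : I -> R) (phi : nat -> I) (S : R)
    (M n : nat) : (forall z, 0 <= b z) -> sum_bounded b S ->
  (forall z, (count (fun k => phi k == z) (iota 0 n) <= M)%N) ->
  \sum_(0 <= k < n) b (phi k) <= M%:R * S.
Proof.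
move=> b0 bS cM; rewrite /index_iota subn0.
pose U := undup (map phi (iota 0 n)).
have -> : \sum_(k <- iota 0 n) b (phi k) =
    \sum_(k <- iota 0 n) \sum_(z <- U) if phi k == z then b z else 0.
  rewrite big_seq [RHS]big_seq; apply: eq_bigr => k kn.
  rewrite (bigD1_seq (phi k)) ?undup_uniq ?mem_undup ?map_f//= eqxx.
  by rewrite big1 ?addr0// => z /negbTE; rewrite eq_sym => ->.
rewrite exchange_big/=.
apply: (@le_trans _ _ (\sum_(z <- U) M%:R * b z)).
  apply: ler_sum => z _; rewrite -big_mkcond/= big_const_seq iter_addr_0.
  by rewrite -[b z *+ _]mulr_natl ler_wpM2r// ler_nat.
by rewrite -mulr_sumr ler_wpM2l// bS// undup_uniq.
Qed.

(** Young's inequality for l^1 against l^rho, read along [phi]. Jensen in [i] costs S^(rho - 1),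
    since the weights have mass at most [S]; after the exchange of sums, summing a translate of [b]
    over [k] costs [M * S]. *)
Lemma sum_convolution_le (b : int -> R) (g : nat -> R) (phi : nat -> int)
    (nn : nat -> nat) (S rho : R) (M : nat) :
  1 <= rho -> (forall z, 0 <= b z) -> (forall i, 0 <= g i) ->
  sum_bounded b S ->
  (forall n z, (count (fun k => phi k == z) (iota 0 n) <= M)%N) ->
  (\sum_(0 <= k <oo)
     ((\sum_(i < nn k) b (phi k - i%:Z)%R * g i)%R `^ rho)%:E <=
   (S `^ rho * M%:R)%:E * \sum_(0 <= i <oo) (g i `^ rho)%:E)%E.
Proof.
move=> rho1 b0 g0 bS cM; have rho0 : 0 < rho by rewrite (lt_le_trans ltr01).
have S0 : 0 <= S by have := bS [::] isT; rewrite big_nil.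
have bS' (x : int) : sum_bounded (fun z => b (x + z)) S.
  move=> U uU; rewrite -(big_map (fun z => x + z) xpredT b) bS//.
  by rewrite map_inj_uniq//; exact: addrI.
have bSN (x : int) (n : nat) : \sum_(i < n) b (x - i%:Z) <= S.
  rewrite -(big_mkord xpredT (fun i => b (x - i%:Z))).
  rewrite -(big_map (fun i : nat => - i%:Z) xpredT (fun z => b (x + z))) bS'//.
  by rewrite map_inj_uniq ?iota_uniq// => i j /oppr_inj [].
pose a k i : \bar R := (S `^ (rho - 1) * (b (phi k - i%:Z) * g i `^ rho))%:E.
have a0 k i : (0 <= a k i)%E.
  by rewrite lee_fin !mulr_ge0 ?powR_ge0.
apply: (@le_trans _ _ (\sum_(0 <= k <oo) \sum_(0 <= i <oo) a k i)%E).
  apply: lee_nneseries => [k _ _|k _]; first by rewrite lee_fin powR_ge0.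
  apply: le_trans (nneseries_lim_ge (nn k) _); last by move=> *; exact: a0.
  rewrite sumEFin lee_fin big_mkord -mulr_sumr.
  apply: le_trans (jensen_powR _ rho1 _ _) _ => //.
  rewrite ler_wpM2r ?sumr_ge0// => [i _|]; first by rewrite mulr_ge0 ?powR_ge0.
  by rewrite ler_powR2r ?subr_ge0 ?sumr_ge0// bSN.
rewrite nneseries_interchange// -nneseriesZl => [|i _]; last first.
  by rewrite lee_fin powR_ge0.
apply: lee_nneseries => [i _ _|i _]; first exact: nneseries_ge0.
apply: lime_le; first exact: is_cvg_nneseries.
apply: nearW => n; rewrite sumEFin lee_fin -mulr_sumr -mulr_suml.
rewrite -(mulr_powRB1 S0 rho0).
have := @sum_fibers_le _ (fun z => b (- i%:Z + z)) phi S M n (fun=> b0 _)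
  (bS' _) (cM n).
under eq_bigr do rewrite addrC.
move=> /(ler_wpM2r (powR_ge0 (g i) rho)) /(ler_wpM2l (powR_ge0 S (rho - 1))).
by move=> /le_trans; apply; rewrite le_eqVlt; apply/orP; left; apply/eqP; ring.
Qed.

(** [X k] stands for the p-th power of an l^p norm. [cost F p q c] is convertible to
    [lq_cost p q (level_coef F p c)], so costs and their bounds are handled by the same lemmas. *)
Definition lq_cost (p : R) (q : \bar R) (X : nat -> R) : \bar R :=
  (if q is r%:E then (\sum_(0 <= k <oo) (X k `^ (r / p)%R)%:E) `^ r^-1
   else ereal_sup (range (fun k => (X k `^ p^-1%R)%:E)))%E.

Lemma lq_cost_ge0 p q X : (0 <= lq_cost p q X)%E.
Proof.
case: q => [r||]/=; first exact: poweR_ge0.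
all: apply: (@le_trans _ _ (X 0%N `^ p^-1)%:E); first by rewrite lee_fin powR_ge0.
all: by apply: ereal_sup_ubound; exists 0%N.
Qed.

Lemma le_lq_cost p q (X Y : nat -> R) : 0 < p -> (0 < q)%E ->
  (forall k, 0 <= X k <= Y k) -> (lq_cost p q X <= lq_cost p q Y)%E.
Proof.
move=> p0 q0 XY.
have le r k : 0 <= r -> X k `^ r <= Y k `^ r.
  by move=> r0; have /andP[X0 XYk] := XY k; rewrite ler_powR2r.
case: q q0 => [r r0||//]/=.
  rewrite lte_fin in r0; apply: lee_poweR; rewrite ?invr_ge0 ?(ltW r0)//.
    by apply: nneseries_ge0 => k _ _; rewrite lee_fin powR_ge0.
  apply: lee_nneseries => k _; first by rewrite lee_fin powR_ge0.
  by rewrite lee_fin le// divr_ge0 ?ltW.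
move=> _; apply: ge_ereal_sup => _ [k _ <-].
apply: (@le_trans _ _ (Y k `^ p^-1)%:E); first by rewrite lee_fin le// invr_ge0 ltW.
by apply: ereal_sup_ubound; exists k.
Qed.

(** For finite [q] this is the convolution estimate with exponent [q / r], applied to L^(r/p): the
    outer power [p / r] turns the q/p-th powers of the cost into q/r-th powers. *)
Lemma lq_cost_convolution (p r : R) (q : \bar R) (b : int -> R) (L : nat -> R)
    (phi : nat -> int) (nn : nat -> nat) (S C : R) (M : nat)
    (u : nat -> nat -> R) :
  0 < r <= 1 -> r <= p -> (r%:E <= q)%E ->
  (forall z, 0 <= b z) -> (forall i, 0 <= L i) -> 0 <= C ->
  (forall i k, 0 <= u i k) ->
  sum_bounded b S ->
  (forall n z, (count (fun k => phi k == z) (iota 0 n) <= M)%N) ->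
  (forall i k, u i k `^ r <= C `^ r * (b (phi k - i%:Z) * L i `^ (r / p))) ->
  (lq_cost p q L < +oo)%E ->
  (lq_cost p q (fun k => (\sum_(i < nn k) u i k `^ r) `^ (p / r))%R <=
   (C * S `^ r^-1 * M%:R `^ fine q^-1)%:E * lq_cost p q L)%E.
Proof.
move=> /andP[r0 r1] rp rq b0 L0 C0 u0 bS cM uC Lfin.
have p0 : 0 < p by rewrite (lt_le_trans r0).
have S0 : 0 <= S by have := bS [::] isT; rewrite big_nil.
have rn0 : r != 0 by rewrite gt_eqF.
have pn0 : p != 0 by rewrite gt_eqF.
pose w k := \sum_(i < nn k) b (phi k - i%:Z) * L i `^ (r / p).
have w0 k : 0 <= w k by rewrite sumr_ge0// => i _; rewrite mulr_ge0 ?powR_ge0.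
have us0 k : 0 <= \sum_(i < nn k) u i k `^ r.
  by rewrite sumr_ge0// => i _; rewrite powR_ge0.
have uw k : \sum_(i < nn k) u i k `^ r <= C `^ r * w k.
  by rewrite mulr_sumr; apply: ler_sum.
(* For [q = +oo] the factor in [M] has exponent 0: a supremum over [k] does not see repeated values
   of [phi k], and only the mass [S] enters. *)
case: q rq Lfin => [q||//] rq; last first.
  move=> Lfin /=; rewrite powRr0 mulr1.
  have Lge0 := lq_cost_ge0 p +oo%E L.
  have : lq_cost p +oo%E L \is a fin_num by rewrite ge0_fin_numE.
  rewrite /lq_cost => /fineK GE; set G := fine _ in GE; rewrite -GE -EFinM.
  have G0 : 0 <= G by rewrite -lee_fin GE.
  have LG i : L i `^ p^-1 <= G.
    by rewrite -lee_fin GE; apply: ereal_sup_ubound; exists i.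
  apply: ge_ereal_sup => _ [k _ <-]; rewrite lee_fin -powRrM mulrAC mulfV// mul1r.
  rewrite -[leRHS](powRK rn0) ?mulr_ge0 ?powR_ge0//.
  rewrite ler_powR2r ?invr_ge0 ?(ltW r0) ?us0//; apply: le_trans (uw k) _.
  rewrite !powRM ?mulr_ge0 ?powR_ge0// powRVK// -mulrA ler_wpM2l ?powR_ge0//.
  apply: (@le_trans _ _ (\sum_(i < nn k) b (phi k - i%:Z) * G `^ r)).
    apply: ler_sum => i _; rewrite ler_wpM2l// (mulrC r) powRrM.
    by rewrite ler_powR2r ?powR_ge0 ?(ltW r0).
  rewrite -mulr_suml ler_wpM2r ?powR_ge0//.
  rewrite -(big_mkord xpredT (fun i => b (phi k - i%:Z))).
  rewrite -(big_map (fun i : nat => phi k - i%:Z) xpredT b) bS//.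
  by rewrite map_inj_uniq ?iota_uniq// => i j /addrI /oppr_inj [].
move=> _ /=; rewrite lee_fin in rq.
have q0 : 0 < q by rewrite (lt_le_trans r0).
have qn0 : q != 0 by rewrite gt_eqF.
have qr1 : 1 <= q / r by rewrite ler_pdivlMr// mul1r.
rewrite inver (negbTE qn0)/=.
apply: (@le_trans _ _ (((C `^ q)%:E * ((S `^ (q / r) * M%:R)%:E *
    \sum_(0 <= i <oo) (L i `^ (q / p))%:E)) `^ q^-1)%E).
  apply: lee_poweR; rewrite ?invr_ge0 ?(ltW q0)//.
    by apply: nneseries_ge0 => k _ _; rewrite lee_fin powR_ge0.
  have := @sum_convolution_le b (fun i => L i `^ (r / p)) phi nn S (q / r) M qr1
    b0 (fun=> powR_ge0 _ _) bS cM.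
  under [X in (_ <= _ * X)%E -> _]eq_eseriesr do
    rewrite -powRrM mulrC mulrA divfK//.
  have Cq0 : (0 <= (C `^ q)%:E)%E by rewrite lee_fin powR_ge0.
  move=> /(lee_wpmul2l Cq0); apply: le_trans.
  rewrite -nneseriesZl => [|k _]; last by rewrite lee_fin powR_ge0.
  apply: lee_nneseries => k _; first by rewrite lee_fin powR_ge0.
  rewrite -EFinM lee_fin -powRrM.
  have -> : p / r * (q / p) = q / r by rewrite mulrC mulrA divfK.
  have -> : C `^ q = (C `^ r) `^ (q / r) by rewrite -powRrM mulrCA mulfV ?mulr1.
  rewrite -powRM ?powR_ge0 ?w0//; apply: ler_powR2r; rewrite ?divr_ge0 ?(ltW q0) ?(ltW r0) ?us0//.
  exact: uw.
rewrite muleA -EFinM poweRM ?lee_fin ?mulr_ge0 ?powR_ge0//; last first.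
  by apply: nneseries_ge0 => k _ _; rewrite lee_fin powR_ge0.
rewrite poweR_EFin !powRM ?mulr_ge0 ?powR_ge0// powRK// mulrA.
rewrite -(powRrM S); have -> : q / r / q = r^-1 by rewrite mulrAC mulfV ?mul1r.
by [].
Qed.


Lemma sum_bounded_geometric (a : R) : 0 < a < 1 ->
  sum_bounded (fun l : nat => a ^+ l) (1 / (1 - a)).
Proof.
move=> /andP[a0 a1] U uU; pose N := (\max_(l <- U) l).+1.
have UN l : l \in U -> (l < N)%N by move=> lU; rewrite ltnS leq_bigmax_seq.
have pU : perm_eq U [seq l <- iota 0 N | l \in U].
  apply: uniq_perm; rewrite ?filter_uniq ?iota_uniq// => l.
  by rewrite mem_filter mem_iota/= add0n; apply/idP/andP => [lU|[]//]; rewrite lU UN.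
rewrite (perm_big _ pU) big_filter.
apply: le_trans (geometric_le_lim N ler01 a0 _); last by rewrite gtr0_norm.
rewrite /series/= /index_iota subn0 big_mkcond/=; apply: ler_sum => l _.
by rewrite mul1r; case: ifP => // _; rewrite exprn_ge0 ?ltW.
Qed.

Lemma bseq_ge0 (lambda alpha A : R) z : 0 <= bseq lambda alpha A z.
Proof. by rewrite /bseq; case: ifP => // _; exact: powR_ge0. Qed.

(** The cutoff in [bseq] leaves only integers from [z0] on, where the theta-th powers form a
    geometric sequence of ratio [a < 1]. All [theta > 0] are covered because the exponent depends on
    the branch of [Theta]. *)
Lemma bseq_sum_bounded (lambda alpha A theta : R) : 0 < lambda < 1 ->
  0 < alpha -> 0 < theta ->
  exists S, sum_bounded (fun z => bseq lambda alpha A z `^ theta) S.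
Proof.
move=> /andP[l0 l1] alpha0 theta0; pose z0 := Num.floor (A / alpha - 1).
pose a := lambda `^ (alpha * theta).
have a01 : 0 < a < 1.
  rewrite powR_gt0//= -(powRr0 lambda) /a /powR gt_eqF// ltr_expR mul0r.
  by rewrite pmulr_rlt0 ?mulr_gt0// ln_lt0// l0.
exists (lambda `^ (alpha * theta * z0%:~R) * (1 / (1 - a))) => U uU.
have bE z : bseq lambda alpha A z `^ theta <= if z0 <= z then
    lambda `^ (alpha * theta * z0%:~R) * a ^+ `|(z - z0)%R|%N else 0.
  rewrite /bseq; case: ltP => [Az|_]; last first.
    rewrite powR0 ?gt_eqF//; case: ifP => // _.
    by rewrite mulr_ge0 ?exprn_ge0 ?powR_ge0.
  have z0z : z0 <= z.
    by rewrite -(ler_int R) (le_trans (floor_le _))// ltW.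
  rewrite z0z -powR_mulrn ?powR_ge0// -!powRrM -powRD; last first.
    by apply/implyP => _; rewrite gt_eqF.
  rewrite natr_absz ger0_norm ?subr_ge0// intrB.
  by rewrite le_eqVlt; apply/orP; left; apply/eqP; congr (_ `^ _); ring.
apply: le_trans (ler_sum _ (fun z _ => bE z)) _.
rewrite -big_mkcond/= -mulr_sumr ler_wpM2l ?powR_ge0//.
rewrite -big_filter -(big_map (fun z => `|(z - z0)%R|%N) xpredT (fun l => a ^+ l)).
apply: (sum_bounded_geometric a01).
rewrite map_inj_in_uniq ?filter_uniq// => x y.
rewrite !mem_filter => /andP[x0 _] /andP[y0 _] /(congr1 Posz).
by rewrite !abszE !ger0_norm ?subr_ge0// => /addIr.
Qed.

(** The bound [S] only shows that the sum is finite; the exact value is then a bound too, and this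
    is what brings [Theta] itself, not some larger number, into the final constant. *)
Lemma sum_bounded_esum (b : int -> R) (S : R) :
  (forall z, 0 <= b z) -> sum_bounded b S ->
  let E := (\esum_(z in [set: int]) (b z)%:E)%E in
  E \is a fin_num /\ sum_bounded b (fine E).
Proof.
move=> b0 bS E; have E0 : (0 <= E)%E by apply: esum_ge0 => z _; rewrite lee_fin.
have ES : (E <= S%:E)%E.
  apply: ge_ereal_sup => _ [X [finX _] <-].
  by rewrite fsbig_finite//= sumEFin lee_fin bS// fset_uniq.
have Efin : E \is a fin_num by rewrite ge0_fin_numE// (le_lt_trans ES) ?ltry.
split=> // U uU; rewrite -lee_fin fineK// -sumEFin; apply: esum_ge.
have fU : finite_set [set` U] by exact: finite_seq.
exists [set` U]; first by split.
rewrite fsbig_finite//= le_eqVlt; apply/orP; left; apply/eqP/perm_big.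
apply: uniq_perm => // [|z]; first exact: fset_uniq.
by rewrite in_fset_set// mem_setE.
Qed.

(** In the order of the branches, [r] is 1, [q], [p], [q], that is min(1, p, q), and the exponent
    [r / p] becomes 1/p, q/p, 1, q/p. *)
Lemma ThetaE (p : R) (q : \bar R) (b : int -> R) : 0 < p -> (0 < q)%E ->
  (forall z, 0 <= b z) ->
  (forall theta, 0 < theta -> exists S, sum_bounded (fun z => b z `^ theta) S) ->
  exists r S : R, [/\ 0 < r <= 1, r <= p, (r%:E <= q)%E,
    sum_bounded (fun z => b z `^ (r / p)) S
    & Theta p q b = (S `^ r^-1)%:E].
Proof.
move=> p0 q0 b0 bS.
have H r : 0 < r <= 1 -> r <= p -> (r%:E <= q)%E ->
    Theta p q b = ((\esum_(z in [set: int]) (b z `^ (r / p))%:E) `^ r^-1)%E ->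
    exists r S : R, [/\ 0 < r <= 1, r <= p, (r%:E <= q)%E,
    sum_bounded (fun z => b z `^ (r / p)) S
    & Theta p q b = (S `^ r^-1)%:E].
  move=> r01 rp rq ->; have rp0 : 0 < r / p by rewrite divr_gt0//; case/andP: r01.
  have [S bS'] := bS _ rp0.
  have [Efin bE] := sum_bounded_esum (fun z => powR_ge0 _ _) bS'.
  exists r, (fine (\esum_(z in [set: int]) (b z `^ (r / p))%:E)%E); split=> //.
  by rewrite -poweR_EFin fineK.
move: H; rewrite /Theta; case: ifPn => p1 H.
  move: H; case: ifPn => q1 H.
    apply: (H 1) => //; first by rewrite ltr01 lexx.
    under [in RHS]eq_esum do rewrite mul1r.
    by rewrite invr1 poweRe1//; apply: esum_ge0 => z _; rewrite lee_fin powR_ge0.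
  rewrite -ltNge in q1; case: q q0 q1 H => [q||]//=; rewrite !lte_fin => q0 q1 H.
  by apply: (H q); rewrite ?q0 ?(ltW q1) ?lexx// (le_trans (ltW q1)).
rewrite -ltNge in p1; move: H; case: ifPn => q1 H.
  apply: (H p) => //; first by rewrite p0 ltW.
  by under [in RHS]eq_esum do rewrite mulfV ?gt_eqF// powRr1//.
rewrite -ltNge in q1; case: q q0 q1 H => [q||]//=; rewrite !lte_fin => q0 q1 H.
by apply: (H q); rewrite ?q0 ?(ltW q1) ?lexx// (le_trans (ltW q1)) // ltW.
Qed.

(** A fiber of floor(k / alpha) consists of integers in a half-open interval of length [alpha], so
    its size is at most the least integer not below [alpha]. *)
Lemma MconstE (alpha : R) : 0 < alpha ->
  exists M : nat, Mconst alpha = M%:R /\ forall (n : nat) (z : int),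
    (count (fun k : nat => Num.floor (k%:R / alpha) == z) (iota 0 n) <= M)%N.
Proof.
move=> alpha0; have : exists n : nat, alpha <= n%:R.
  by exists (Num.bound alpha); rewrite ltW// archi_boundP// ltW.
(* The least natural number not below [alpha] is [l + 1], so [l] is the maximum occurring in
   [Mconst]. *)
case/ex_minnP => -[|l]; first by rewrite leNgt alpha0.
move=> al lmin.
have la : l%:R < alpha by rewrite ltNge; apply/negP => /lmin; rewrite ltnn.
exists l.+1; split.
  rewrite /Mconst -natr1; congr (_ + _); apply/eqP; rewrite eq_le; apply/andP; split.
    apply: ge_sup => [|_ [j /= ja <-]]; first by exists l%:R, l.
    by rewrite ler_nat -ltnS -(ltr_nat R) (lt_le_trans ja).
  apply: ub_le_sup; last by exists l.
  by exists alpha => _ [j /= ja <-]; exact: ltW.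
move=> n z; have [/hasP[k0]|] := boolP (has
    (fun k : nat => Num.floor (k%:R / alpha) == z) (iota 0 n)); last first.
  by rewrite has_count -leqNgt leqn0 => /eqP ->.
move=> _ k0z.
(* The fiber fits into the [l + 1] consecutive integers starting at its least element [k1], because
   [alpha <= l + 1]. *)
have /ex_minnP[k1 k1z kmin] : exists k : nat, Num.floor (k%:R / alpha) == z.
  by exists k0.
rewrite -size_filter -(size_iota k1 l.+1); apply: uniq_leq_size.
  by rewrite filter_uniq// iota_uniq.
move=> k; rewrite mem_filter => /andP[kz _]; rewrite mem_iota kmin//=.
rewrite -(ltr_nat R) natrD.
move: kz k1z; rewrite !floor_eq => /andP[_ +] /andP[+ _].
rewrite ltr_pdivrMr// ler_pdivlMr// intrD1 => H1 H2; nra.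
Qed.

End sequences.

(** * Summability from (G2) and the constant [K] *)

Section summability.
Context {R : realType}.

(* [min(1, p)], written as the exponent of [rep_abs]. *)
Definition texp (p : R) : R := p / Num.max 1 p.

Lemma texp_gt0 p : 0 < p -> 0 < texp p.
Proof. by move=> p0; rewrite divr_gt0// lt_max ltr01. Qed.

Lemma texp_ge1 p : 1 <= p -> texp p = 1.
Proof. by move=> p1; rewrite /texp max_r// divff// gt_eqF// (lt_le_trans ltr01). Qed.

Lemma texp_lt1 p : p < 1 -> texp p = p.
Proof. by move=> p1; rewrite /texp max_l ?divr1// ltW. Qed.

Lemma hoelder_conjugateEFin (r : R) : 1 < r ->
  hoelder_conjugate r%:E = (r / (r - 1))%:E.
Proof.
move=> r1; rewrite /hoelder_conjugate/= eqe gt_eqF ?(lt_trans ltr01)//.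
by rewrite -EFinB inver subr_eq0 gt_eqF.
Qed.

(** With t = min(1, p) the four branches of [Gamma] become two: if q > t the weights w^(s t) lie in
    l^((q/t)'), otherwise they are bounded. *)
Lemma Gamma_weights (s p : R) (q : \bar R) (w : nat -> R) :
  0 < p -> (0 < q)%E -> (forall k, 0 <= w k) ->
  (Gamma p q (fun k => w k `^ (s * p))%R < +oo)%E ->
  if ((texp p)%:E < q)%E then
    (\sum_(0 <= k <oo) (w k `^ (s * texp p *
       fine (hoelder_conjugate (q / (texp p)%:E)%E))%R)%:E < +oo)%E : Prop
  else exists V, forall k, w k `^ s <= V.
Proof.
move=> p0 q0 w0; rewrite /Gamma.
have supV : (ereal_sup (range (fun k => ((w k `^ (s * p)) `^ p^-1)%R%:E)) < +oo)%E ->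
    exists V, forall k, w k `^ s <= V.
  set e := ereal_sup _ => efin.
  have ek k : ((w k `^ s)%:E <= e)%E.
    apply: ereal_sup_ubound; exists k => //.
    by rewrite -powRrM -mulrA mulfV ?mulr1// gt_eqF.
  have e0 : (0 <= e)%E by rewrite (le_trans _ (ek 0%N))// lee_fin powR_ge0.
  by exists (fine e) => k; rewrite -lee_fin fineK// ge0_fin_numE.
have hc_gt0 (x : \bar R) : (1 < x)%E -> 0 < fine (hoelder_conjugate x).
  case: x => [x||]//; rewrite ?lte_fin => x1.
    by rewrite hoelder_conjugateEFin//= divr_gt0 ?subr_gt0// (lt_trans ltr01).
case: ifPn => p1.
  rewrite (texp_ge1 p1); case: ifPn => q1; last by move=> /supV.
  rewrite inve1 mule1 mulr1 => /lty_poweRy.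
  rewrite invr_eq0 gt_eqF ?hc_gt0// => /(_ isT).
  under eq_eseriesr do rewrite -powRrM -mulrA [p * _]mulrC divfK ?gt_eqF//.
  by [].
rewrite -ltNge in p1; rewrite (texp_lt1 p1); case: ifPn => q1; last by move=> /supV.
have qp1 : (1 < q / p%:E)%E.
  case: q q0 q1 {supV} => [q||]//; rewrite ?lte_fin => q0 q1.
    by rewrite inver gt_eqF// -EFinM lte_fin ltr_pdivlMr// mul1r.
  by rewrite inver gt_eqF// gt0_mulye ?ltry// lte_fin invr_gt0.
move=> /lty_poweRy; rewrite invr_eq0 gt_eqF ?mulr_gt0 ?hc_gt0// => /(_ isT).
by under eq_eseriesr do rewrite -powRrM.
Qed.

(** The duality hidden in (G2), with t = min(1, p): for q > t, X^(t/p) lies in l^(q/t) and w^(s t)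
    in the dual space. As only finiteness is claimed, Young's inequality term by term replaces
    Hoelder's when [q] is finite. *)
Lemma Gamma_summable (s p : R) (q : \bar R) (w X : nat -> R) :
  0 < p -> (0 < q)%E -> (forall k, 0 <= w k) -> (forall k, 0 <= X k) ->
  (Gamma p q (fun k => w k `^ (s * p))%R < +oo)%E ->
  (lq_cost p q X < +oo)%E ->
  (\sum_(0 <= k <oo) ((w k `^ s * X k `^ p^-1) `^ texp p)%R%:E < +oo)%E.
Proof.
move=> p0 q0 w0 X0 /(Gamma_weights p0 q0 w0) Gfin Xfin.
have t0 := texp_gt0 p0; set t := texp p in t0 Gfin *; clearbody t.
have tE k : (w k `^ s * X k `^ p^-1) `^ t = w k `^ (s * t) * X k `^ (t / p).
  by rewrite powRM ?powR_ge0// -!powRrM (mulrC p^-1).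
under eq_eseriesr do rewrite tE.
case: q q0 Gfin Xfin => [q||]// q0.
  rewrite lte_fin in q0.
  rewrite lte_fin; case: ifPn => tq => [Wfin|[V wV]] Xfin.
    have qt1 : 1 < q / t by rewrite ltr_pdivlMr// mul1r.
    move: Wfin; rewrite inver gt_eqF// -EFinM hoelder_conjugateEFin//=.
    set eta := (X in s * t * X) => Wfin.
    have eta0 : 0 < eta by rewrite divr_gt0 ?subr_gt0// (lt_trans ltr01).
    have qt0 : 0 < q / t by rewrite divr_gt0.
    have conj : (q / t)^-1 + eta^-1 = 1.
      have -> : eta^-1 = 1 - (q / t)^-1.
        by rewrite /eta [LHS]invf_div mulrBl divff ?gt_eqF// mul1r.
      by rewrite addrC subrK.
    move/lty_poweRy : Xfin; rewrite invr_neq0 ?gt_eqF// => /(_ isT) Xfin.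
    apply: le_lt_trans (lte_add_pinfty Xfin Wfin).
    rewrite -nneseriesD; try by move=> *; rewrite lee_fin powR_ge0.
    apply: lee_nneseries => [k _ _|k _].
      by rewrite lee_fin mulr_ge0 ?powR_ge0.
    rewrite -EFinD lee_fin mulrC.
    apply: le_trans (conjugate_powR (powR_ge0 _ _) (powR_ge0 _ _) qt0 eta0 conj) _.
    rewrite -!powRrM (_ : t / p * (q / t) = q / p); last first.
      by rewrite mulrC mulrA divfK// gt_eqF.
    apply: lerD; rewrite ler_piMr ?powR_ge0// -conj ?lerDl ?lerDr invr_ge0 ltW//.
  move/lty_poweRy : Xfin; rewrite invr_neq0 ?gt_eqF// => /(_ isT) Xfin.
  set Y := (\sum_(0 <= k <oo) _)%E in Xfin.
  have Yk k : ((X k `^ (q / p))%:E <= Y)%E.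
    apply: le_trans (nneseries_lim_ge k.+1 _); last first.
      by move=> *; rewrite lee_fin powR_ge0.
    by rewrite big_nat_recr//= leeDr// sume_ge0// => i _; rewrite lee_fin powR_ge0.
  have Y0 : (0 <= Y)%E by rewrite (le_trans _ (Yk 0%N))// lee_fin powR_ge0.
  have Yf : Y \is a fin_num by rewrite ge0_fin_numE.
  have V0 : 0 <= V by rewrite (le_trans _ (wV 0%N))// powR_ge0.
  rewrite -leNgt in tq.
  (* Here q <= t, and l^q embeds in l^t: each X^(q/p) is at most the total [Y], so raising it to the
     power t/q >= 1 costs only the factor Y^(t/q - 1). *)
  apply: (@le_lt_trans _ _ (\sum_(0 <= k <oo) ((V `^ t *
      fine Y `^ (t / q - 1))%:E * (X k `^ (q / p))%:E))%E); last first.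
    rewrite nneseriesZl => [|k _]; last by rewrite lee_fin powR_ge0.
    by rewrite -/Y -(fineK Yf) -EFinM ltry.
  apply: lee_nneseries => [k _ _|k _]; first by rewrite lee_fin mulr_ge0 ?powR_ge0.
  rewrite -EFinM lee_fin -[leRHS]mulrA (powRrM (w k)) ler_pM ?powR_ge0 ?mulr_ge0 ?powR_ge0//.
    by rewrite ler_powR2r ?powR_ge0 ?(ltW t0).
  have -> : t / p = (q / p) * (t / q) by rewrite [RHS]mulrC mulrA divfK// gt_eqF.
  have tq0 : 0 < t / q by rewrite divr_gt0.
  rewrite powRrM -(mulr_powRB1 (powR_ge0 _ _) tq0) mulrC ler_wpM2r ?powR_ge0//.
  rewrite ler_powR2r ?powR_ge0//; first by rewrite subr_ge0 ler_pdivlMr// mul1r.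
  by rewrite -lee_fin fineK.
(* For [q = +oo] the conjugate exponent of q/t is 1: the w^(s t) are summable and [X] is bounded. *)
rewrite ltry inver gt_eqF// gt0_mulye ?lte_fin ?invr_gt0// hoelder_conjugatey/=.
rewrite mulr1 => Wfin Xfin.
set G := ereal_sup _ in Xfin.
have Gk k : ((X k `^ p^-1)%:E <= G)%E by apply: ereal_sup_ubound; exists k.
have G0 : (0 <= G)%E by rewrite (le_trans _ (Gk 0%N))// lee_fin powR_ge0.
have Gf : G \is a fin_num by rewrite ge0_fin_numE.
apply: (@le_lt_trans _ _ (\sum_(0 <= k <oo) ((fine G `^ t)%:E *
    (w k `^ (s * t))%:E))%E); last first.
  rewrite nneseriesZl => [|k _]; last by rewrite lee_fin powR_ge0.
  apply: lte_mul_pinfty => //; rewrite ?lee_fin ?powR_ge0//.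
apply: lee_nneseries => [k _ _|k _]; first by rewrite lee_fin mulr_ge0 ?powR_ge0.
rewrite -EFinM lee_fin mulrC ler_wpM2r ?powR_ge0// (mulrC t) powRrM.
by rewrite ler_powR2r ?powR_ge0 ?(ltW t0)// -lee_fin fineK.
Qed.

End summability.

(** * From levels of [G] to levels of [W]: where the constant [K] comes from *)

Section transfer.
Context {R : realType}.
Variables (p alpha A B lambda C0 C1 : R) (kk : nat -> nat).
Hypothesis p0 : 0 < p.
Hypothesis alpha0 : 0 < alpha.
Hypothesis hkk : forall i, alpha * i%:R + A <= (kk i)%:R <= alpha * i%:R + B.
Hypothesis lambda01 : 0 < lambda < 1.
Hypothesis C00 : 0 <= C0.
Hypothesis C10 : 0 <= C1.

(* Bound for the [l^p] norm over [P \in W^k] of the coefficients that the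
   elements of [G^i] contribute, when [L i] is the level coefficient of [c]. *)
Definition transfer (L : nat -> R) (i k : nat) : R :=
  if (kk i <= k)%N then C1 * (C0 * lambda ^+ (k - kk i) * L i) `^ p^-1 else 0.

Lemma transfer_ge0 L i k : 0 <= transfer L i k.
Proof. by rewrite /transfer; case: ifP => // _; rewrite mulr_ge0 ?powR_ge0. Qed.

(** With z = floor(k / alpha), the inequality alpha z <= k and (II) give k - k_i >= alpha (z - i) -
    B, and [lambda < 1] turns this into the decay of [bseq] with the factor lambda^(-B). The lower
    bound in (II) and k_i <= k give z - i > A / alpha - 1, so [bseq] is not on its zero branch. *)
Lemma transfer_powR_le (r : R) L i k : 0 < r -> (forall i, 0 <= L i) ->
  transfer L i k `^ r <= (C1 * C0 `^ p^-1 * lambda `^ (- B / p)) `^ r *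
    (bseq lambda alpha A (Num.floor (k%:R / alpha) - i%:Z) `^ (r / p) *
     L i `^ (r / p)).
Proof.
move=> r0 L0; have /andP[l0 l1] := lambda01; rewrite /transfer; case: ifPn => ik.
  set z := Num.floor (k%:R / alpha).
  have /andP[zl zu] : z%:~R <= k%:R / alpha < (z + 1)%:~R by exact: floor_itv.
  have /andP[ki1 ki2] := hkk i.
  have ikR : (kk i)%:R <= k%:R :> R by rewrite ler_nat.
  have -> : bseq lambda alpha A (z - i%:Z) =
      lambda `^ (alpha * (z%:~R - i%:R)).
    rewrite /bseq ifT; last first.
      rewrite intrB /=; rewrite intrD1 in zu.
      have : A / alpha + i%:R <= k%:R / alpha.
        rewrite ler_pdivlMr// mulrDl divfK ?gt_eqF//; lra.
      by move=> H; rewrite ltrBrDr; lra.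
    by rewrite intrB.
  have lp x : 0 <= lambda `^ x := powR_ge0 _ _.
  have rE x : x `^ (r / p) = (x `^ p^-1) `^ r by rewrite mulrC powRrM.
  rewrite !rE -!powRM ?mulr_ge0 ?powR_ge0//; apply: ler_powR2r; rewrite ?(ltW r0)//.
    by rewrite mulr_ge0 ?powR_ge0.
  have -> : lambda `^ (- B / p) = (lambda `^ (- B)) `^ p^-1 by rewrite -powRrM.
  rewrite -!mulrA ler_wpM2l// -!powRM ?mulr_ge0 ?powR_ge0// ?exprn_ge0 ?(ltW l0)//.
  apply: ler_powR2r; rewrite ?invr_ge0 ?(ltW p0) ?mulr_ge0 ?exprn_ge0 ?(ltW l0)//.
  rewrite ler_wpM2l// mulrA ler_wpM2r// -powR_mulrn ?(ltW l0)//.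
  rewrite -powRD; last by apply/implyP => _; rewrite gt_eqF.
  apply: ger_powR; first by rewrite l0 ltW.
  rewrite natrB// mulrBr.
  have : alpha * z%:~R <= k%:R by rewrite mulrC -ler_pdivlMr.
  lra.
by rewrite powR0 ?gt_eqF// !mulr_ge0 ?powR_ge0.
Qed.

(** (II) makes k_i tend to infinity, so only finitely many levels of [G] reach a given level of [W];
    the sums over [i] at a fixed level [k] are finite for this reason. *)
Lemma transfer_cutoff : exists nn : nat -> nat, forall k i, (nn k <= i)%N -> (k < kk i)%N.
Proof.
exists (fun k => (Num.bound `|(k%:R - A) / alpha|)) => k i ki.
have H : (k%:R - A) / alpha < i%:R.
  apply: le_lt_trans (ler_norm _) _.
  by apply: lt_le_trans (archi_boundP (normr_ge0 _)) _; rewrite ler_nat.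
rewrite -(ltr_nat R); have /andP[ki1 _] := hkk i.
by rewrite (lt_le_trans _ ki1)// -ltrBlDr mulrC -ltr_pdivrMr.
Qed.

(** [C1] stands for the overlap constant. The exponent [r] stays visible because later estimates
    must use the same one, and the constant is exhibited as a real number to avoid indeterminate
    products. *)
Lemma Kconst_transfer (q : \bar R) : (0 < q)%E ->
  exists r : R, [/\ 0 < r <= 1, r <= p, (r%:E <= q)%E &
    exists K : R, 0 <= K /\
    (C1%:E * (C0 `^ p^-1)%:E * (lambda `^ (- B / p))%:E *
     Theta p q (bseq lambda alpha A) * (Mconst alpha `^ fine q^-1%E)%:E = K%:E)%E /\
    forall (L : nat -> R) (nn : nat -> nat), (forall i, 0 <= L i) ->
      (lq_cost p q L < +oo)%E ->
      (lq_cost p q (fun k => (\sum_(i < nn k) transfer L i k `^ r) `^ (p / r))%R <=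
       K%:E * lq_cost p q L)%E].
Proof.
move=> q0; have [M [ME cM]] := MconstE alpha0.
have [r [S [r01 rp rq bS ->]]] := ThetaE p0 q0 (@bseq_ge0 R lambda alpha A)
  (fun theta => @bseq_sum_bounded R lambda alpha A theta lambda01 alpha0).
exists r; split => //.
exists (C1 * C0 `^ p^-1 * lambda `^ (- B / p) * S `^ r^-1 * Mconst alpha `^ fine q^-1%E).
have Cge0 : 0 <= C1 * C0 `^ p^-1 * lambda `^ (- B / p) by rewrite !mulr_ge0 ?powR_ge0.
split; first by rewrite !mulr_ge0 ?powR_ge0.
split; first by rewrite -!EFinM.
move=> L nn L0 Lfin; rewrite ME.
apply: (@lq_cost_convolution R p r q _ L _ nn S _ M (transfer L) r01 rp rq _ L0 Cge0
   (transfer_ge0 L) bS cM) => // [z|i k]; first exact: powR_ge0.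
by apply: transfer_powR_le => //; case/andP: r01.
Qed.

End transfer.

(** * The quasi-norm of [L^p] *)

Section complex_modulus.
Context {R : realType}.
Implicit Types z w : R[i].

Lemma normc_ge0 z : 0 <= Normc.normc z.
Proof. by case: z => a b; rewrite /Normc.normc sqrtr_ge0. Qed.

Lemma normcD_le z w : Normc.normc (z + w) <= Normc.normc z + Normc.normc w.
Proof. exact: (@le_normcD R z w). Qed.

Lemma normc_N z : Normc.normc (- z) = Normc.normc z.
Proof. exact: (@normcN R z). Qed.

Lemma normcE z : Normc.normc z = Num.sqrt (complex.Re z ^+ 2 + complex.Im z ^+ 2).
Proof. by case: z. Qed.

Lemma normc_sum_le (I : Type) (r : seq I) (P : pred I) (F : I -> R[i]) :
  Normc.normc (\sum_(i <- r | P i) F i) <= \sum_(i <- r | P i) Normc.normc (F i).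
Proof.
elim/big_ind2 : _ => //; first by rewrite Normc.normc0.
by move=> a x b y ax byy; rewrite (le_trans (normcD_le _ _))// lerD.
Qed.

Lemma Re_le_normc z : `|complex.Re z| <= Normc.normc z.
Proof. by rewrite normcE -sqrtr_sqr ler_sqrt ?lerDl ?addr_ge0 ?sqr_ge0. Qed.

Lemma Im_le_normc z : `|complex.Im z| <= Normc.normc z.
Proof. by rewrite normcE -sqrtr_sqr ler_sqrt ?lerDr ?addr_ge0 ?sqr_ge0. Qed.

Lemma normc_le_ReIm z : Normc.normc z <= `|complex.Re z| + `|complex.Im z|.
Proof.
rewrite normcE -[leRHS]ger0_norm ?addr_ge0// -sqrtr_sqr ler_sqrt ?sqr_ge0//.
rewrite sqrrD !real_normK ?num_real// [leRHS]addrAC lerDl.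
by rewrite mulrn_wge0// mulr_ge0.
Qed.

Lemma normc_real (a : R) : 0 <= a -> Normc.normc (a%:C)%C = a.
Proof. by move=> a0; rewrite normcE/= expr0n addr0 sqrtr_sqr ger0_norm. Qed.

Lemma ReD z w : complex.Re (z + w) = complex.Re z + complex.Re w.
Proof. by case: z; case: w. Qed.
Lemma ImD z w : complex.Im (z + w) = complex.Im z + complex.Im w.
Proof. by case: z; case: w. Qed.
Lemma ReM z w : complex.Re (z * w) =
  complex.Re z * complex.Re w - complex.Im z * complex.Im w.
Proof. by case: z; case: w. Qed.
Lemma ImM z w : complex.Im (z * w) =
  complex.Re z * complex.Im w + complex.Im z * complex.Re w.
Proof. by case: z; case: w. Qed.
Lemma ReN z : complex.Re (- z) = - complex.Re z. Proof. by case: z. Qed.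
Lemma ImN z : complex.Im (- z) = - complex.Im z. Proof. by case: z. Qed.

Lemma Re_sum (I : Type) (r : seq I) (P : pred I) (F : I -> R[i]) :
  complex.Re (\sum_(i <- r | P i) F i) = \sum_(i <- r | P i) complex.Re (F i).
Proof. by elim/big_ind2 : _ => // a x b y <- <-; rewrite ReD. Qed.
Lemma Im_sum (I : Type) (r : seq I) (P : pred I) (F : I -> R[i]) :
  complex.Im (\sum_(i <- r | P i) F i) = \sum_(i <- r | P i) complex.Im (F i).
Proof. by elim/big_ind2 : _ => // a x b y <- <-; rewrite ImD. Qed.

End complex_modulus.

Section cmeasurable.
Context {d : measure_display} {T : measurableType d} {R : realType}.
Implicit Types f g : T -> R[i].

Lemma cmeasurableD f g : cmeasurable f -> cmeasurable g ->
  cmeasurable (fun x => f x + g x).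
Proof.
move=> [f1 f2] [g1 g2]; split.
  by under eq_fun do rewrite ReD; exact: measurable_funD.
by under eq_fun do rewrite ImD; exact: measurable_funD.
Qed.

Lemma cmeasurableN f : cmeasurable f -> cmeasurable (fun x => - f x).
Proof.
move=> [f1 f2]; split.
  by under eq_fun do rewrite ReN; exact: measurable_funN.
by under eq_fun do rewrite ImN; exact: measurable_funN.
Qed.

Lemma cmeasurableB f g : cmeasurable f -> cmeasurable g ->
  cmeasurable (fun x => f x - g x).
Proof. by move=> mf mg; apply: cmeasurableD => //; exact: cmeasurableN. Qed.

Lemma cmeasurable_cst (z : R[i]) : cmeasurable (fun _ : T => z).
Proof. by split; exact: measurable_cst. Qed.

Lemma cmeasurableZ (z : R[i]) f : cmeasurable f -> cmeasurable (fun x => z * f x).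
Proof.
move=> [f1 f2]; split.
  under eq_fun do rewrite ReM.
  by apply: measurable_funB; apply: measurable_funM.
under eq_fun do rewrite ImM.
by apply: measurable_funD; apply: measurable_funM.
Qed.

Lemma cmeasurable_sum (I : Type) (r : seq I) (F : I -> T -> R[i]) :
  (forall i, cmeasurable (F i)) -> cmeasurable (fun x => \sum_(i <- r) F i x).
Proof.
move=> mF; split.
  under eq_fun do rewrite Re_sum.
  by apply: measurable_sum => i; case: (mF i).
under eq_fun do rewrite Im_sum.
by apply: measurable_sum => i; case: (mF i).
Qed.

Lemma cmeasurable_sum_in (I : eqType) (r : seq I) (F : I -> T -> R[i]) :
  (forall i, i \in r -> cmeasurable (F i)) -> cmeasurable (fun x => \sum_(i <- r) F i x).
Proof.
elim: r => [|i r IH] mF.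
  by under eq_fun do rewrite big_nil; exact: cmeasurable_cst.
under eq_fun do rewrite big_cons; apply: cmeasurableD.
  by apply: mF; rewrite mem_head.
by apply: IH => j jr; apply: mF; rewrite in_cons jr orbT.
Qed.

Lemma cmeasurable_normc f : cmeasurable f ->
  measurable_fun setT (fun x => Normc.normc (f x)).
Proof.
move=> [f1 f2].
have -> : (fun x => Normc.normc (f x)) =
    (fun a : R => a `^ 2^-1) \o (fun x => complex.Re (f x) ^+ 2 + complex.Im (f x) ^+ 2).
  by apply/funext => x/=; rewrite powR12_sqrt ?normcE// addr_ge0 ?sqr_ge0.
apply: measurableT_comp; first exact: measurable_powR.
by apply: measurable_funD; apply: measurable_funX.
Qed.

Lemma measurable_normc_powR (p : R) f : cmeasurable f ->
  measurable_fun setT (fun x => (Normc.normc (f x) `^ p)%:E).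
Proof.
move=> mf; apply/measurable_EFinP.
by apply: measurableT_comp (measurable_powR p) _; exact: cmeasurable_normc.
Qed.

End cmeasurable.

Lemma cvge0P (R : realType) (u : nat -> \bar R) : (forall n, (0 <= u n)%E) ->
  u @ \oo --> 0%E <-> (forall e : R, 0 < e -> \forall n \near \oo, (u n <= e%:E)%E).
Proof.
move=> u0; split=> [/fine_cvgP[ufin /cvgr0Pnorm_le uc] e e0|H].
  near=> n; have un : u n \is a fin_num by near: n.
  rewrite -(fineK un) lee_fin (le_trans (ler_norm _))//.
  by near: n; exact: uc.
apply/fine_cvgP; split.
  near=> n; rewrite ge0_fin_numE//; apply: (@le_lt_trans _ _ 1%:E); last exact: ltry.
  by near: n; exact: H.
apply/cvgr0Pnorm_le => e e0; near=> n => /=.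
have une : (u n <= e%:E)%E by near: n; exact: H.
rewrite ger0_norm ?fine_ge0// -lee_fin fineK// ge0_fin_numE//.
by rewrite (le_lt_trans une)// ltry.
Unshelve. all: by end_near. Qed.

Lemma cvge0_poweR (R : realType) (u : nat -> \bar R) (r : R) : 0 < r ->
  (forall n, (0 <= u n)%E) -> u @ \oo --> 0%E ->
  (fun n => u n `^ r)%E @ \oo --> 0%E.
Proof.
move=> r0 u0 /(cvge0P u0) uc; apply/cvge0P => [n|e e0]; first exact: poweR_ge0.
have := uc (e `^ r^-1) (powR_gt0 _ e0); apply: filterS => n une.
apply: le_trans (lee_poweR (ltW r0) (u0 n) une) _.
by rewrite poweR_EFin powRVK ?gt_eqF// ltW.
Qed.

Lemma le_cvge0 (R : realType) (u v : nat -> \bar R) :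
  (forall n, (0 <= u n)%E) -> (forall n, (u n <= v n)%E) -> v @ \oo --> 0%E ->
  u @ \oo --> 0%E.
Proof.
move=> u0 uv; apply: squeeze_cvge (cvg_cst 0%E).
by apply: nearW => n; rewrite u0 uv.
Qed.

Section quasinorm.
Context {d : measure_display} {T : measurableType d} {R : realType}.
Variable m : {measure set T -> \bar R}.
Variable p : R.
Hypothesis p0 : 0 < p.
Implicit Types f g : T -> R[i].

Let t0 : 0 < texp p := texp_gt0 p0.
Let tp0 : 0 < texp p / p := divr_gt0 t0 p0.

(* For [p < 1] the quasi-norm is not subadditive, but its power [p] is. *)
Definition qnorm f : \bar R := (cnorm m p%:E f `^ texp p)%E.

Definition Lp_int f : \bar R := (\int[m]_x (Normc.normc (f x) `^ p)%:E)%E.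

Lemma Lp_int_ge0 f : (0 <= Lp_int f)%E.
Proof. by apply: integral_ge0 => x _; rewrite lee_fin powR_ge0. Qed.

Lemma cnormE f : cnorm m p%:E f = (Lp_int f `^ p^-1)%E.
Proof.
rewrite /cnorm unlock /Lp_int; congr (_ `^ _)%E; apply: eq_integral => x _.
by rewrite /= ger0_norm ?normc_ge0.
Qed.

Lemma cnorm_ge0 q f : (0 <= cnorm m q f)%E.
Proof. exact: Lnorm_ge0. Qed.

Lemma qnormE f : qnorm f = (Lp_int f `^ (texp p / p))%E.
Proof. by rewrite /qnorm cnormE -poweRrM mulrC. Qed.

Lemma qnorm_ge0 f : (0 <= qnorm f)%E. Proof. exact: poweR_ge0. Qed.

Lemma Lp_int_qnorm f : Lp_int f = (qnorm f `^ (p / texp p))%E.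
Proof.
rewrite qnormE -poweRrM mulrA divfK ?gt_eqF// divff ?gt_eqF//.
by rewrite poweRe1// Lp_int_ge0.
Qed.

Lemma cnorm_qnorm f : cnorm m p%:E f = (qnorm f `^ (texp p)^-1)%E.
Proof. by rewrite /qnorm -poweRrM divff ?gt_eqF// poweRe1// cnorm_ge0. Qed.

Lemma qnorm_lty f : (qnorm f < +oo)%E <-> (cnorm m p%:E f < +oo)%E.
Proof.
split=> [|H]; last exact: poweR_lty.
by apply: lty_poweRy; rewrite gt_eqF.
Qed.

Lemma Lp_int_le f g : cmeasurable f -> cmeasurable g ->
  {ae m, forall x, Normc.normc (f x) <= Normc.normc (g x)} ->
  (Lp_int f <= Lp_int g)%E.
Proof.
move=> mf mg fg; apply: ae_ge0_le_integral => //.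
- by move=> x _; rewrite lee_fin powR_ge0.
- exact: measurable_normc_powR.
- by move=> x _; rewrite lee_fin powR_ge0.
- exact: measurable_normc_powR.
- by apply: filterS fg => x fgx _; rewrite lee_fin ler_powR2r ?(ltW p0)// normc_ge0.
Qed.

Lemma qnorm_le f g : cmeasurable f -> cmeasurable g ->
  {ae m, forall x, Normc.normc (f x) <= Normc.normc (g x)} ->
  (qnorm f <= qnorm g)%E.
Proof.
move=> mf mg fg; by rewrite !qnormE; apply: lee_poweR (ltW tp0) (Lp_int_ge0 _) (Lp_int_le mf mg fg).
Qed.

Lemma qnormN f : qnorm (fun x => - f x) = qnorm f.
Proof.
by rewrite !qnormE; congr (_ `^ _)%E; apply: eq_integral => x _; rewrite normc_N.
Qed.

Lemma qnorm0 : qnorm (fun=> 0) = 0%E.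
Proof.
rewrite qnormE (_ : Lp_int _ = 0%E).
  by rewrite poweR0r// gt_eqF.
apply: integral0_eq => x _; rewrite Normc.normc0 powR0//.
by rewrite gt_eqF.
Qed.

(** For p >= 1 this is Minkowski's inequality; for p < 1 the integrand |f|^p is already subadditive
    pointwise. *)
Lemma qnormD f g : cmeasurable f -> cmeasurable g ->
  (qnorm (fun x => (f x + g x)%R) <= qnorm f + qnorm g)%E.
Proof.
move=> mf mg; have mfg := cmeasurableD mf mg.
have nf := cmeasurable_normc mf; have ng := cmeasurable_normc mg.
have [p1|p1] := leP 1 p.
  rewrite /qnorm !texp_ge1// !poweRe1 ?cnorm_ge0//.
  apply: le_trans (minkowski_EFin m nf ng p1).
  rewrite cnormE unlock; apply: lee_poweR; rewrite ?invr_ge0 ?(ltW p0) ?Lp_int_ge0//.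
  apply: ge0_le_integral => //.
  - by move=> x _; rewrite lee_fin powR_ge0.
  - exact: measurable_normc_powR.
  - apply/measurable_EFinP; apply: measurableT_comp (measurable_powR p) _.
    by apply: measurableT_comp => //; exact: measurable_funD.
  - move=> x _ /=; rewrite lee_fin ler_powR2r ?(ltW p0) ?normc_ge0//.
    by rewrite ger0_norm ?normcD_le// addr_ge0// normc_ge0.
rewrite !qnormE texp_lt1// divff ?gt_eqF// !poweRe1 ?Lp_int_ge0//.
rewrite /Lp_int -ge0_integralD//; do ?
  [exact: measurable_normc_powR | by move=> x _; rewrite lee_fin powR_ge0].
apply: ge0_le_integral => //.
- by move=> x _; rewrite lee_fin powR_ge0.
- exact: measurable_normc_powR.
- by apply: emeasurable_funD; exact: measurable_normc_powR.
- move=> x _; rewrite -EFinD lee_fin.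
  apply: le_trans (ler_powR2r (ltW p0) (normc_ge0 _) (normcD_le _ _)) _.
  by rewrite powRD_le ?normc_ge0// p0 ltW.
Qed.

Lemma qnorm_sum (I : Type) (r : seq I) (F : I -> T -> R[i]) :
  (forall i, cmeasurable (F i)) ->
  (qnorm (fun x => \sum_(i <- r) F i x)%R <= \sum_(i <- r) qnorm (F i))%E.
Proof.
move=> mF; elim: r => [|i r IH].
  by rewrite big_nil; under [X in qnorm X]eq_fun do rewrite big_nil; rewrite qnorm0.
rewrite big_cons; under [X in qnorm X]eq_fun do rewrite big_cons.
apply: le_trans (qnormD (mF i) _) _; first exact: cmeasurable_sum.
by rewrite leeD2l.
Qed.

Lemma qnormB f g h : cmeasurable f -> cmeasurable g -> cmeasurable h ->
  (qnorm (fun x => (f x - h x)%R) <=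
   qnorm (fun x => (f x - g x)%R) + qnorm (fun x => (g x - h x)%R))%E.
Proof.
move=> mf mg mh; have := qnormD (cmeasurableB mf mg) (cmeasurableB mg mh).
by under [X in qnorm X]eq_fun do rewrite addrA subrK.
Qed.

Lemma Lp_cvgP (S : nat -> T -> R[i]) g :
  Lp_cvg m p%:E S g <-> (fun n => qnorm (fun x => S n x - g x)) @ \oo --> 0%E.
Proof.
split=> H; first by apply: cvge0_poweR => // n; exact: cnorm_ge0.
rewrite /Lp_cvg; under eq_fun do rewrite cnorm_qnorm.
by apply: cvge0_poweR; rewrite ?invr_gt0// => n; exact: qnorm_ge0.
Qed.

Lemma LpP g : Lp m p%:E g <-> cmeasurable g /\ (qnorm g < +oo)%E.
Proof. by split=> -[mg] /qnorm_lty. Qed.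

End quasinorm.

(** * Completeness of [L^p] and double series *)

Section limits.
Context {R : realType}.
Implicit Types u v : nat -> \bar R.

Lemma limn_einf_ge u (c : \bar R) :
  (\forall n \near \oo, (c <= u n)%E) -> (c <= limn_einf u)%E.
Proof.
move=> [N _ uN]; rewrite limn_einf_lim; apply: lime_ge; first exact: is_cvg_einfs.
exists N => // n /= Nn; apply: le_ereal_inf_tmp => _ [k /= nk <-].
by apply: uN; rewrite /= (leq_trans Nn).
Qed.

Lemma limn_einf_le u (c : \bar R) :
  (forall n, (u n <= c)%E) -> (limn_einf u <= c)%E.
Proof.
move=> uc; rewrite limn_einf_lim; apply: lime_le; first exact: is_cvg_einfs.
by apply: nearW => n; apply: le_trans (uc n); apply: ereal_inf_lbound; exists n => /=.
Qed.

Lemma limn_esup_EFin (x : nat -> R) (l : R) :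
  x @ \oo --> l -> limn_esup (fun n => (x n)%:E) = l%:E.
Proof.
move=> xl; have H : (fun n => (x n)%:E) @ \oo --> l%:E.
  by apply: cvg_EFin => //; exact: nearW.
by have [_ ->] := cvg_limn_einf_sup H.
Qed.

Lemma cvge0D u v : (forall n, (0 <= u n)%E) -> (forall n, (0 <= v n)%E) ->
  u @ \oo --> 0%E -> v @ \oo --> 0%E -> (fun n => u n + v n)%E @ \oo --> 0%E.
Proof.
move=> u0 v0 /(cvge0P u0) uc /(cvge0P v0) vc.
apply/cvge0P => [n|e e0]; first exact: adde_ge0.
have e20 : 0 < e / 2 by rewrite divr_gt0.
near=> n; rewrite (splitr e) EFinD leeD//; near: n; [exact: uc|exact: vc].
Unshelve. all: by end_near. Qed.

Lemma cvge0Z (a : R) u : 0 <= a ->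
  (forall n, (0 <= u n)%E) -> u @ \oo --> 0%E ->
  (fun n => a%:E * u n)%E @ \oo --> 0%E.
Proof.
move=> a0 u0 /(cvge0P u0) uc.
apply/cvge0P => [n|e e0]; first by rewrite mule_ge0 ?lee_fin.
have a1 : 0 < a + 1 by rewrite ltr_wpDl.
have := uc (e / (a + 1)) (divr_gt0 e0 a1); apply: filterS => n une.
apply: (@le_trans _ _ (a%:E * (e / (a + 1))%:E)%E).
  by apply: lee_wpmul2l; rewrite ?lee_fin.
rewrite -EFinM lee_fin mulrCA ler_piMr ?(ltW e0)//.
by rewrite ler_pdivrMr// mul1r lerDl.
Qed.

Lemma lee_add_cvge0 (x y : \bar R) u : (forall n, (0 <= u n)%E) ->
  u @ \oo --> 0%E -> (forall n, (x <= y + u n)%E) -> (x <= y)%E.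
Proof.
move=> u0 /(cvge0P u0) uc xy; apply/lee_addgt0Pr => e /uc [n _ /(_ n (leqnn _)) un].
by apply: le_trans (xy n) _; rewrite leeD2l.
Qed.

Lemma cvge0_sum (n : nat) (u : 'I_n -> nat -> \bar R) :
  (forall i k, (0 <= u i k)%E) -> (forall i, u i @ \oo --> 0%E) ->
  (fun k => \sum_(i < n) u i k)%E @ \oo --> 0%E.
Proof.
elim: n u => [|n IH] u u0 uc; first by under eq_fun do rewrite big_ord0; exact: cvg_cst.
under eq_fun do rewrite big_ord_recr/=.
by apply: cvge0D => //; [move=> k; exact: sume_ge0|exact: IH].
Qed.

Lemma big_ord_trailing0 (V : zmodType) (a b : nat) (F : nat -> V) : (a <= b)%N ->
  (forall i, (a <= i)%N -> F i = 0) -> \sum_(i < a) F i = \sum_(i < b) F i.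
Proof.
move=> ab F0; rewrite -(subnKC ab) big_split_ord/= [X in _ = _ + X]big1 ?addr0//.
by move=> i _; rewrite F0// leq_addr.
Qed.

Lemma abs_summable_cvg (a : nat -> R) (B : R) :
  (forall n, \sum_(j < n) `|a j| <= B) ->
  exists l : R, (fun n => \sum_(j < n) a j) @ \oo --> l.
Proof.
move=> aB; have : cvgn (series (a : R^o ^nat)).
  apply: normed_cvg; apply: nondecreasing_is_cvgn.
    by apply: nondecreasing_series => i _ _; exact: normr_ge0.
  by exists B => _ [n _ <-]; have := aB n; rewrite -(big_mkord xpredT (fun j => `|a j|)).
rewrite (_ : series _ = (fun n => \sum_(j < n) a j)); last first.
  by apply/funext => n; rewrite seriesEord.
by move=> ac; exists (lim ((fun n => \sum_(j < n) a j) @ \oo)).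
Qed.

End limits.

Section completeness.
Context {d : measure_display} {T : measurableType d} {R : realType}.
Variable m : {measure set T -> \bar R}.
Variable p : R.
Hypothesis p0 : 0 < p.

Local Notation qn := (qnorm m p).

(** Monotone convergence for the p-th powers of the partial sums of the moduli: their integrals stay
    below a power of the total, so the increasing limit is integrable, hence finite almost
    everywhere. *)
Lemma ae_bounded_partial_sums (f : nat -> T -> R[i]) :
  (forall n, cmeasurable (f n)) ->
  (\sum_(0 <= n <oo) qn (f n) < +oo)%E ->
  {ae m, forall x, exists B, forall n, \sum_(j < n) Normc.normc (f j x) <= B}.
Proof.
move=> mf; set V := (\sum_(0 <= n <oo) _)%E => Vfin.
have t0 := texp_gt0 p0.
have qn0 g : (0 <= qn g)%E by exact: qnorm_ge0.
pose A n x := \sum_(j < n) Normc.normc (f j x).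
have A0 n x : 0 <= A n x by rewrite sumr_ge0// => j _; exact: normc_ge0.
pose Ac n x : R[i] := \sum_(j < n) (Normc.normc (f j x))%:C%C.
have AcE n x : Normc.normc (Ac n x) = A n x.
  by rewrite /Ac -(rmorph_sum (real_complex R)) -/(A n x) normc_real.
have mn n : cmeasurable (fun x => (Normc.normc (f n x))%:C%C).
  by split => /=; [exact: cmeasurable_normc|exact: measurable_cst].
have mAc n : cmeasurable (Ac n) by apply: cmeasurable_sum => j; exact: mn.
have AcV n : (qn (Ac n) <= V)%E.
  apply: le_trans (nneseries_lim_ge n _) => [|i _ _]; last exact: qn0.
  rewrite big_mkord; apply: le_trans (qnorm_sum _ _ _ _) _ => //.
  apply: lee_sum => j _; apply: qnorm_le => //.
  by apply: nearW => x; rewrite normc_real ?normc_ge0.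
pose g n x := ((A n x) `^ p)%:E.
have mg n : measurable_fun setT (g n).
  have -> : g n = (fun x => (Normc.normc (Ac n x) `^ p)%:E).
    by apply/funext => x; rewrite AcE.
  exact: measurable_normc_powR.
have g0 n x : (0 <= g n x)%E by rewrite lee_fin powR_ge0.
have ndg x : {homo g^~ x : n k / (n <= k)%N >-> (n <= k)%E}.
  move=> n k nk; rewrite lee_fin ler_powR2r ?(ltW p0)// /A.
  rewrite -(subnKC nk) big_split_ord/= lerDl sumr_ge0// => j _; exact: normc_ge0.
have cg x : cvgn (g^~ x) by exact: ereal_nondecreasing_is_cvgn.
have gV n : (\int[m]_x g n x <= V `^ (p / texp p))%E.
  have -> : (\int[m]_x g n x)%E = Lp_int m p (Ac n).
    by apply: eq_integral => x _; rewrite AcE.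
  rewrite Lp_int_qnorm//; apply: lee_poweR => //.
  by rewrite divr_ge0 ?ltW.
have lim0 x : (0 <= limn (g^~ x))%E by apply: lime_ge => //; apply: nearW => n.
have : m.-integrable setT (fun x => limn (g^~ x)).
  apply/integrableP; split.
    by apply: (emeasurable_fun_cvg _ _ mg) => x _; exact: cg.
  under eq_integral do rewrite gee0_abs//.
  have H := @cvg_monotone_convergence _ _ _ m _ measurableT _ mg (fun n x _ => g0 n x)
    (fun x _ => @ndg x).
  rewrite -(cvg_lim _ H)//; apply: (@le_lt_trans _ _ (V `^ (p / texp p))%E).
    apply: lime_le; first by apply/cvg_ex; eexists; exact: H.
    by apply: nearW => n; exact: gV.
  exact: poweR_lty.
move=> /(integrable_ae measurableT); apply: filterS => x /(_ I) lfin.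
exists (fine (limn (g^~ x)) `^ p^-1) => n.
rewrite -[leLHS](powRK (lt0r_neq0 p0)) -/(A n x)//.
rewrite ler_powR2r ?invr_ge0 ?(ltW p0) ?powR_ge0// -lee_fin fineK//.
by apply: lime_ge => //; exists n => // k /= nk; exact: ndg.
Qed.

(** Riesz-Fischer in series form for every p > 0: absolute summability gives a pointwise limit
    almost everywhere, and Fatou's lemma bounds its distance to the partial sums by the tails. *)
Lemma Lp_complete (f : nat -> T -> R[i]) :
  (forall n, cmeasurable (f n)) ->
  (\sum_(0 <= n <oo) qn (f n) < +oo)%E ->
  exists g, Lp m p%:E g /\ Lp_cvg m p%:E (fun n x => \sum_(j < n) f j x) g.
Proof.
move=> mf Vfin; have t0 := texp_gt0 p0.
have qn0 g : (0 <= qn g)%E by exact: qnorm_ge0.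
pose S n x := \sum_(j < n) f j x.
have mS n : cmeasurable (S n) by apply: cmeasurable_sum.
(* Upper limits are measurable on the whole space, and they agree with the limits wherever the
   partial sums converge, that is, almost everywhere. *)
pose a x := fine (limn_esup (fun n => (complex.Re (S n x))%:E)).
pose b x := fine (limn_esup (fun n => (complex.Im (S n x))%:E)).
pose g x := (a x +i* b x)%C.
have mg : cmeasurable g.
  split; (apply: (measurableT_comp (fine_measurable measurableT)));
    by apply: measurable_fun_limn_esup => n; apply/measurable_EFinP; case: (mS n).
have Sg : {ae m, forall x, (fun n => Normc.normc (g x - S n x)) @ \oo --> 0}.
  apply: filterS (ae_bounded_partial_sums mf Vfin) => x [B AB].
  have [l Sl] : exists l : R, (fun n => complex.Re (S n x)) @ \oo --> l.
    rewrite (_ : (fun n => _) = fun n => \sum_(j < n) complex.Re (f j x)); last first.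
      by apply/funext => n; rewrite /S Re_sum.
    apply: (@abs_summable_cvg _ (fun j => complex.Re (f j x)) B) => n; apply: le_trans (AB n).
    by apply: ler_sum => j _; exact: Re_le_normc.
  have [l' Sl'] : exists l : R, (fun n => complex.Im (S n x)) @ \oo --> l.
    rewrite (_ : (fun n => _) = fun n => \sum_(j < n) complex.Im (f j x)); last first.
      by apply/funext => n; rewrite /S Im_sum.
    apply: (@abs_summable_cvg _ (fun j => complex.Im (f j x)) B) => n; apply: le_trans (AB n).
    by apply: ler_sum => j _; exact: Im_le_normc.
  have al : a x = l.
    by rewrite /a (limn_esup_EFin Sl).
  have bl : b x = l'.
    by rewrite /b (limn_esup_EFin Sl').
  apply/cvgr0Pnorm_le => e e0.
  have e20 : 0 < e / 2 by rewrite divr_gt0.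
  near=> n; rewrite ger0_norm ?normc_ge0// (le_trans (normc_le_ReIm _))//.
  rewrite ReD ImD ReN ImN /= al bl (splitr e) lerD//; near: n.
    by move/cvgrPdist_le : Sl; apply.
  by move/cvgrPdist_le : Sl'; apply.
have m2 n : cmeasurable (fun x => 2^-1 * (g x - S n x)).
  by apply: cmeasurableZ; exact: cmeasurableB.
pose tail n := (\sum_(n <= j <oo) qn (f j))%E.
have tail0 n : (0 <= tail n)%E by apply: nneseries_ge0.
(* Fatou is applied to one half of the difference: the limit inferior then
   exceeds the integrand pointwise without any continuity of the power. *)
have half n : (qn (fun x => 2^-1 * (g x - S n x))%R <= tail n)%E.
  pose h M x := (Normc.normc (S (n + M)%N x - S n x) `^ p)%:E.
  have mh M : measurable_fun setT (h M).
    by apply: measurable_normc_powR; exact: cmeasurableB.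
  have h0 M x : (0 <= h M x)%E by rewrite lee_fin powR_ge0.
  suff : (Lp_int m p (fun x => 2^-1 * (g x - S n x))%R <= tail n `^ (p / texp p))%E.
    have tp0 : 0 < texp p / p by rewrite divr_gt0.
    move=> /(lee_poweR (ltW tp0) (Lp_int_ge0 _ _ _)).
    rewrite -qnormE// -poweRrM mulrA divfK ?lt0r_neq0// divff ?lt0r_neq0//.
    by rewrite poweRe1.
  apply: (@le_trans _ _ (\int[m]_x limn_einf (h^~ x))%E).
    apply: ae_ge0_le_integral => //.
    - by move=> x _; rewrite lee_fin powR_ge0.
    - exact: measurable_normc_powR.
    - by move=> x _; apply: limn_einf_ge; apply: nearW => M.
    - apply: (emeasurable_fun_cvg (fun k x => einfs (h^~ x) k)) => [k|x _].
        exact: measurable_fun_einfs.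
      by rewrite limn_einf_lim; exact: is_cvg_einfs.
    - apply: filterS Sg => x Sgx _; apply: limn_einf_ge.
      set D := g x - S n x; rewrite Normc.normcM.
      have -> : Normc.normc (2^-1 : R[i]) = 2^-1.
        by rewrite Normc.normcV (_ : 2 = (2%:R : R)%:C%C) ?normc_real// rmorph_nat.
      have := normc_ge0 D; rewrite le_eqVlt => /predU1P[<-|D0].
        by apply: nearW => M; rewrite mulr0 powR0 ?lt0r_neq0.
      have D20 : 0 < Normc.normc D / 2 by rewrite divr_gt0.
      move/cvgr0Pnorm_le : Sgx => /(_ _ D20) [K _ SK]; exists K => // M /= KM.
      have := SK (n + M)%N (leq_trans KM (leq_addl _ _)).
      rewrite /= ger0_norm ?normc_ge0// => gM.
      rewrite lee_fin ler_powR2r ?(ltW p0) ?mulr_ge0 ?normc_ge0//.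
      have := normcD_le (S (n + M)%N x - S n x) (g x - S (n + M)%N x).
      rewrite addrC addrA subrK -/D => DM.
      by rewrite mulrC; lra.
  apply: le_trans (fatou m measurableT mh (fun M x _ => h0 M x)) _.
  apply: limn_einf_le => M.
  rewrite -[X in (X <= _)%E]/(Lp_int m p (fun x => S (n + M)%N x - S n x)).
  rewrite Lp_int_qnorm//; apply: lee_poweR => //.
    by rewrite divr_ge0 ?ltW.
  have -> : (fun x => S (n + M)%N x - S n x) = (fun x => \sum_(j < M) f (n + j)%N x).
    by apply/funext => x; rewrite /S big_split_ord/= addrAC subrr add0r.
  apply: le_trans (qnorm_sum m p0 _ (fun j => mf _)) _.
  apply: le_trans (nneseries_lim_ge (n + M)%N _) => [|i _ _]; last exact: qn0.
  rewrite -[X in \sum_(X <= _ < _) _]add0n big_addn addKn big_mkord.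
  by apply: lee_sum => j _; rewrite addnC.
have Sn n : (qn (fun x => (g x - S n x)%R) <= tail n + tail n)%E.
  have -> : (fun x => g x - S n x) =
      (fun x => 2^-1 * (g x - S n x) + 2^-1 * (g x - S n x)).
    by apply/funext => x; rewrite -mulrDl [X in X * _](_ : _ = 1) ?mul1r//;
      rewrite -mulr2n -[LHS]mulr_natl mulfV// pnatr_eq0.
  by apply: le_trans (qnormD m p0 (m2 n) (m2 n)) _; rewrite leeD.
exists g; split.
  apply/LpP => //; split => //.
  have := Sn 0%N; under [X in qn X]eq_fun do rewrite /S big_ord0 subr0.
  by move/le_lt_trans; apply; rewrite lte_add_pinfty.
apply/Lp_cvgP => //; apply: (@le_cvge0 _ _ (fun n => tail n + tail n)%E) => // [n|].
  rewrite -qnormN//; under [X in qn X]eq_fun do rewrite opprB.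
  exact: Sn.
by apply: cvge0D => //; exact: nneseries_tail_cvg.
Unshelve. all: by end_near. Qed.

(** Once cut at column [K], the two orders of summation differ only in rows from [n] on, which are
    bounded by the tail of the row sums [a]. The error [e K] of the cut vanishes as [K] grows with
    [n] fixed. *)
Lemma Lp_double_series (f : nat -> nat -> T -> R[i]) (nn : nat -> nat)
    (S : nat -> T -> R[i]) :
  (forall i k, cmeasurable (f i k)) -> (forall i, cmeasurable (S i)) ->
  (forall i k x, (nn k <= i)%N -> f i k x = 0) ->
  (\sum_(0 <= k <oo) \sum_(i < nn k) qn (f i k) < +oo)%E ->
  (forall i, Lp_cvg m p%:E (fun K x => \sum_(k < K) f i k x) (S i)) ->
  exists g, [/\ Lp m p%:E g,
    (\sum_(0 <= k <oo) qn (fun x => (\sum_(i < nn k) f i k x)%R) < +oo)%E,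
    Lp_cvg m p%:E (fun K x => \sum_(k < K) \sum_(i < nn k) f i k x) g &
    Lp_cvg m p%:E (fun n x => \sum_(i < n.+1) S i x) g].
Proof.
move=> mf mS f0 Vfin Sc.
have qn0 g : (0 <= qn g)%E by exact: qnorm_ge0.
pose L k x := \sum_(i < nn k) f i k x.
have mL k : cmeasurable (L k) by apply: cmeasurable_sum.
have Lfin : (\sum_(0 <= k <oo) qn (L k) < +oo)%E.
  apply: le_lt_trans Vfin; apply: lee_nneseries => [k _ _|k _] => //.
  exact: qnorm_sum.
have [g [Lg Lc]] := Lp_complete mL Lfin.
have [mg _] := Lg.
exists g; split=> //.
pose a i := (\sum_(0 <= k <oo) qn (f i k))%E.
have a0 i : (0 <= a i)%E by apply: nneseries_ge0.
have afin : (\sum_(0 <= i <oo) a i < +oo)%E.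
  rewrite nneseries_interchange//; apply: le_lt_trans Vfin.
  apply: lee_nneseries => [k _ _|k _]; first exact: nneseries_ge0.
  apply: lime_le; first exact: is_cvg_nneseries.
  apply: nearW => n; rewrite -(big_mkord xpredT (fun i => qn (f i k))).
  have [nk|nk] := leqP n (nn k).
    by rewrite (big_cat_nat (leq0n n) nk)//= leeDl// sume_ge0.
  rewrite (big_cat_nat (leq0n _) (ltnW nk))//= [X in (_ + X)%E]big_nat_cond.
  rewrite [X in (_ + X)%E]big1 ?adde0//.
  move=> i /andP[/andP[ki _] _].
  rewrite (_ : f i k = fun=> 0) ?qnorm0//; apply/funext => x; exact: f0.
have tailc := nneseries_tail_cvg afin (fun i _ => a0 i).
apply/Lp_cvgP => //.
suff H n : (qn (fun x => (\sum_(i < n) S i x - g x)%R) <= \sum_(n <= i <oo) a i)%E.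
  apply: le_cvge0 (fun n => H n.+1) _ => [n|]; first exact: qn0.
  by move: tailc; rewrite -(cvg_shiftS (fun n => (\sum_(n <= i <oo) a i)%E)).
pose e K := (qn (fun x => (\sum_(k < K) L k x - g x)%R) +
  \sum_(i < n) qn (fun x => (S i x - \sum_(k < K) f i k x)%R))%E.
have e0 K : (0 <= e K)%E by rewrite adde_ge0// sume_ge0.
apply: (lee_add_cvge0 e0).
  apply: cvge0D => [K|K||]; [exact: qn0|exact: sume_ge0| |].
    by apply/Lp_cvgP.
  apply: cvge0_sum => [i K|i]; first exact: qn0.
  have /(Lp_cvgP m p0) := Sc i.
  by under eq_fun do (rewrite -qnormN//; under [X in qn X]eq_fun do rewrite opprB).
move=> K; have mLK : cmeasurable (fun x => \sum_(k < K) L k x).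
  by apply: cmeasurable_sum.
pose A i x := \sum_(k < K) f i k x.
have mA i : cmeasurable (A i) by apply: cmeasurable_sum.
have mSn : cmeasurable (fun x => \sum_(i < n) S i x) by apply: cmeasurable_sum.
have mAn : cmeasurable (fun x => \sum_(i < n) A i x) by apply: cmeasurable_sum.
apply: le_trans (qnormB m p0 mSn mLK mg) _.
rewrite /e [leRHS]addeCA [leLHS]addeC; apply: leeD2l.
apply: le_trans (qnormB m p0 mSn mAn mLK) _; rewrite [leRHS]addeC; apply: leeD.
  under [X in qn X]eq_fun do rewrite -sumrB.
  by apply: (@qnorm_sum _ _ _ m p p0 _ _ (fun (i : 'I_n) x => S i x - A i x)) => i;
    exact: cmeasurableB.
(* A common bound for the [nn k] with [k < K]: all column sums may be extended by zeros to the same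
   range of rows. *)
pose M := (\sum_(k < K) nn k)%N.
have LA x : \sum_(k < K) L k x = \sum_(i < n + M) A i x.
  rewrite exchange_big/=; apply: eq_bigr => k _.
  apply: (big_ord_trailing0 (F := fun i => f i k x)) => [|i ki]; last exact: f0.
  by rewrite /M (bigD1 k)//= addnCA leq_addr.
have -> : (fun x => \sum_(i < n) A i x - \sum_(k < K) L k x) =
    (fun x => - \sum_(j < M) A (n + j)%N x).
  by apply/funext => x; rewrite LA big_split_ord/= opprD addrA subrr sub0r.
rewrite qnormN//; apply: le_trans (@qnorm_sum _ _ _ m p p0 _ _ (fun (j : 'I_M) => A (n + j)%N)
  (fun j => mA _)) _.
apply: le_trans (nneseries_lim_ge (n + M)%N _) => [|i _ _]; last exact: a0.
rewrite -[X in \sum_(X <= _ < _) _]add0n big_addn addKn big_mkord.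
apply: lee_sum => j _; rewrite addnC; apply: le_trans (@qnorm_sum _ _ _ m p p0 _ _
  (fun k : 'I_K => f (j + n)%N k) (fun k => mf _ _)) _.
by apply: le_trans (nneseries_lim_ge K _) => //; rewrite big_mkord.
Qed.

End completeness.

(** * Atoms *)

Section overlap.
Context {d : measure_display} {T : measurableType d} {R : realType}.
Variable m : {measure set T -> \bar R}.
Variable P : nat -> set (set T).
Hypothesis gP : is_grid m P.
Hypothesis P1 : G1 (R := R) P.

Lemma grid_inhabited k Q : P k Q -> Q !=set0.
Proof.
move=> PQ; apply/set0P/eqP => Q0; have := grid_gt0 gP PQ.
by rewrite Q0 measure0 ltxx.
Qed.

Lemma mem_level k Q : (Q \in fset_set (P k)) = `[< P k Q >].
Proof. by rewrite in_fset_set ?inE; [|exact: grid_finite gP k]. Qed.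

(** All members of a level that contain [x] meet any one of them, so (G1) bounds their number. The
    bound is at least 1 because a set of positive measure is non-empty and meets itself. *)
Lemma overlap_constP : exists D : R, [/\ overlap_const P = D%:E, 1 <= D &
  forall k x, (count (fun Q => `[< Q x >]) (fset_set (P k)))%:R <= D].
Proof.
pose nb k Q := #|` fset_set [set P' | P k P' /\ P' `&` Q !=set0]|.
have fin k Q : finite_set [set P' | P k P' /\ P' `&` Q !=set0].
  by apply: sub_finite_set (grid_finite gP k) => P' [].
have nbD k Q : P k Q -> ((nb k Q)%:R%:E <= overlap_const (R := R) P)%E.
  by move=> PQ; apply: ereal_sup_ubound; exists k, Q.
have D1 : (1%:E <= overlap_const (R := R) P)%E.
  have [k [Q PQ]] := grid_nonempty gP; apply: le_trans (nbD _ _ PQ).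
  rewrite lee_fin ler1n cardfs_gt0; apply/fset0Pn; exists Q.
  rewrite in_fset_set// inE; split=> //; rewrite setIid; exact: grid_inhabited PQ.
have Dfin : overlap_const (R := R) P \is a fin_num.
  by rewrite ge0_fin_numE; [exact: P1|apply: le_trans D1; rewrite lee_fin].
exists (fine (overlap_const P)); split; first by rewrite fineK.
  by rewrite -lee_fin fineK.
move=> k x; rewrite -lee_fin fineK//.
have [/hasP[Q Qk /asboolP Qx]|] := boolP (has (fun Q => `[< Q x >]) (fset_set (P k))).
  rewrite mem_level in Qk; move/asboolP in Qk.
  apply: le_trans (nbD _ _ Qk); rewrite lee_fin ler_nat -size_filter.
  apply: uniq_leq_size => [|P']; first by rewrite filter_uniq// fset_uniq.
  rewrite mem_filter mem_level => /andP[/asboolP P'x /asboolP P'k].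
  by rewrite in_fset_set// inE; split=> //; exists x.
by rewrite has_count -leqNgt leqn0 => /eqP ->; apply: le_trans D1; rewrite lee_fin.
Qed.

End overlap.

Lemma ae_all_seq {d : measure_display} {T : measurableType d} {R : realType}
    (m : {measure set T -> \bar R}) (I : eqType) (r : seq I) (E : I -> T -> Prop) :
  (forall i, i \in r -> {ae m, forall x, E i x}) ->
  {ae m, forall x, forall i, i \in r -> E i x}.
Proof.
elim: r => [|i r IH] Er; first by apply: nearW => x i; rewrite in_nil.
have Ei : {ae m, forall x, E i x} by apply: Er; rewrite mem_head.
have {}IH : {ae m, forall x, forall i, i \in r -> E i x}.
  by apply: IH => j jr; apply: Er; rewrite in_cons jr orbT.
by apply: filterS2 Ei IH => x Eix Erx j; rewrite in_cons => /predU1P[->//|]; exact: Erx.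
Qed.

Section atoms.
Context {d : measure_display} {T : measurableType d} {R : realType}.
Variable m : {measure set T -> \bar R}.
Hypothesis mfin : (m setT < +oo)%E.
Variables (W : nat -> set (set T)) (s p : R) (u : \bar R) (A : @atom_class d T R).
Hypothesis p0 : 0 < p.
Hypothesis s0 : 0 < s.
Hypothesis u1 : (1 <= u)%E.
Hypothesis gW : is_grid m W.
Hypothesis aA : is_atom_class m W s p u A.

Lemma atom_cmeasurable k Q phi : W k Q -> atoms A Q phi -> cmeasurable phi.
Proof.
move=> WQ /(atom_A3_sub aA WQ) Bphi.
by have [E [iota [_ _ _ /(_ phi) [/(_ Bphi)[]]]]] := atom_A1 aA WQ.
Qed.

Lemma atom_vanishes k Q phi : W k Q -> atoms A Q phi ->
  {ae m, forall x, ~ Q x -> phi x = 0}.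
Proof. by move=> WQ /(atom_A3_sub aA WQ); exact: (atom_A2 aA WQ). Qed.

Lemma grid_measure_fin k Q : W k Q -> m Q \is a fin_num.
Proof.
move=> /(grid_measurable gW) mQ; rewrite ge0_fin_numE//.
by apply: le_lt_trans mfin; apply: le_measure => //; rewrite inE.
Qed.

Lemma fine_grid_measure_gt0 k Q : W k Q -> 0 < fine (m Q).
Proof.
by move=> WQ; rewrite fine_gt0// (grid_gt0 gW WQ)/= ltey_eq (grid_measure_fin WQ).
Qed.

Lemma integral_indic_powR Q (r : R) : measurable Q -> 0 < r ->
  (\int[m]_x ((\1_Q x : R) `^ r)%:E = m Q)%E.
Proof.
move=> mQ r0; have -> : m Q = m (Q `&` setT) by rewrite setIT.
rewrite -integral_indic//.
apply: eq_integral => x _; rewrite indicE; case: (x \in Q) => /=.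
  by rewrite powR1.
by rewrite powR0// lt0r_neq0.
Qed.

(** Hoelder's inequality on [Q] with exponents [u] and u': the loss |Q|^(1/(u' p)) in passing from
    L^(pu) to L^p cancels the correction in (A4) and leaves |Q|^s. For [u = +oo] an essential bound
    replaces it, and for [u = 1] (A4) is already the claim. *)
Lemma atom_Lp_int k Q phi : W k Q -> atoms A Q phi ->
  (Lp_int m p phi <= (fine (m Q) `^ (s * p))%:E)%E.
Proof.
move=> WQ aphi; have mphi := atom_cmeasurable WQ aphi.
have mQ := grid_measurable gW WQ; have mQfin := grid_measure_fin WQ.
have M0 := fine_grid_measure_gt0 WQ; set M := fine (m Q) in M0 *.
have mQE : m Q = M%:E by rewrite fineK.
have supp := atom_vanishes WQ aphi.
have pn0 : p != 0 by rewrite lt0r_neq0.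
have := atom_A4 aA WQ aphi; rewrite mQE.
have := Lp_int_ge0 m p phi.
have mpow : measurable_fun setT (fun x => Normc.normc (phi x) `^ p).
  by apply: measurableT_comp (measurable_powR p) _; exact: cmeasurable_normc.
have mind (c : R) (r : R) : measurable_fun setT (fun x => c * (\1_Q x : R) `^ r).
  apply: measurable_funM => //; apply: measurableT_comp (measurable_powR r) _.
  exact: measurable_indic.
case: u u1 => [v||]//; last first.
  move=> _ _; rewrite gt0_muley ?lte_fin// hoelder_conjugatey mul1e inver (negbTE pn0)/=.
  set c := M `^ (s - p^-1) => phic.
  have phicx : {ae m, forall x, Normc.normc (phi x) <= c}.
    move: phic; rewrite /cnorm unlock ifT; last first.
      apply: lt_le_trans (grid_gt0 gW WQ) _.
      by apply: le_measure => //; rewrite inE.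
    move=> /ess_supP; apply: filterS => x /=.
    by rewrite lee_fin ger0_norm ?normc_ge0.
  apply: (@le_trans _ _ (\int[m]_x (c `^ p * (\1_Q x : R) `^ 1)%:E)%E).
    apply: ae_ge0_le_integral => //.
    - by move=> x _; rewrite lee_fin powR_ge0.
    - exact/measurable_EFinP.
    - by move=> x _; rewrite lee_fin mulr_ge0 ?powR_ge0.
    - exact/measurable_EFinP.
    - apply: filterS2 supp phicx => x sx cx _; rewrite lee_fin indicE.
      have [Qx|/negP Qx] := boolP (x \in Q).
        by rewrite powR1 mulr1 ler_powR2r ?normc_ge0 ?(ltW p0).
      rewrite sx; last by move=> /mem_set.
      by rewrite Normc.normc0 powR0// mulr_ge0 ?powR_ge0.
  under eq_integral do rewrite EFinM.
  rewrite ge0_integralZl_EFin ?powR_ge0//; do ?[by move=> x _; rewrite lee_fin powR_ge0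
    | by apply/measurable_EFinP; have := mind 1 1; under eq_fun do rewrite mul1r].
  rewrite integral_indic_powR// mQE -EFinM lee_fin /c -powRrM.
  rewrite mulrBl mulVf// powRB; last by apply/implyP => _; rewrite lt0r_neq0.
  by rewrite powRr1 ?(ltW M0)// divfK// lt0r_neq0.
rewrite lee_fin => v1 _; rewrite -EFinM => phiM.
have v0 : 0 < v by rewrite (lt_le_trans ltr01).
have [v1E|vn1] := eqVneq v 1.
  move: phiM; rewrite v1E hoelder_conjugate1 gt0_mulye ?lte_fin// invey/= subr0 mulr1.
  move=> /(lee_poweR (ltW p0) (cnorm_ge0 _ _ _)).
  by rewrite cnormE// -poweRrM mulVf// poweRe1 ?Lp_int_ge0// poweR_EFin -powRrM.
have {v1}v1 : 1 < v by rewrite lt_neqAle eq_sym vn1.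
have w0 : 0 < v / (v - 1) by rewrite divr_gt0// subr_gt0.
move: phiM; rewrite hoelder_conjugateEFin// -EFinM inver ifF; last first.
  by apply/negbTE; rewrite mulf_neq0// lt0r_neq0.
rewrite /= => phiM.
have pv0 : 0 < p * v by rewrite mulr_gt0.
have mi : measurable_fun setT (\1_Q : T -> R) by exact: measurable_indic.
have H := @hoelder _ _ _ m (fun x => Normc.normc (phi x) `^ p) (\1_Q : T -> R)
  v (v / (v - 1)) mpow mi v0 w0.
have vw : v^-1 + (v / (v - 1))^-1 = 1.
  by rewrite [(v / _)^-1]invf_div mulrBl mul1r divff ?lt0r_neq0// addrC subrK.
apply: (@le_trans _ _ (\int[m]_x `|(Normc.normc (phi x) `^ p * \1_Q x)%:E|)%E).
  apply: ae_ge0_le_integral => //.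
  - by move=> x _; rewrite lee_fin powR_ge0.
  - exact/measurable_EFinP.
  - apply: measurableT_comp => //; apply/measurable_EFinP.
    by apply: measurable_funM => //; exact: measurable_indic.
  - apply: filterS supp => x sx _; rewrite lee_fin indicE.
    have [Qx|/negP Qx] := boolP (x \in Q); first by rewrite mulr1 ler_norm.
    rewrite sx; last by move=> /mem_set.
    by rewrite Normc.normc0 powR0// normr_ge0.
rewrite -(Lnorm1 m (fun x => (Normc.normc (phi x) `^ p * \1_Q x)%:E)).
apply: le_trans (H vw) _.
have -> : ('N[m]_v%:E[(fun x => (Normc.normc (phi x) `^ p)%:E)] =
    cnorm m (p * v)%:E phi `^ p)%E.
  have e : (p * v)^-1 * p = v^-1 by rewrite invfM mulrAC mulVf ?mul1r.
  rewrite cnormE// -poweRrM e unlock.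
  congr (_ `^ _)%E; apply: eq_integral => x _.
  by rewrite /= ger0_norm ?powR_ge0// -powRrM.
have -> : ('N[m]_(v / (v - 1))%:E[EFin \o (\1_Q : T -> R)] =
    (M `^ (v / (v - 1))^-1)%:E)%E.
  rewrite unlock; rewrite (_ : (\int[m]_x _)%E = M%:E) ?poweR_EFin//.
  rewrite -mQE -(integral_indic_powR mQ w0); apply: eq_integral => x _.
  by rewrite /= ger0_norm.
apply: (@le_trans _ _ ((M `^ (s - (v / (v - 1) * p)^-1) `^ p)%:E *
    (M `^ (v / (v - 1))^-1)%:E)%E).
  apply: lee_wpmul2r; first by rewrite lee_fin powR_ge0.
  rewrite -poweR_EFin; apply: lee_poweR; rewrite ?(ltW p0)//; exact: cnorm_ge0.
rewrite -EFinM lee_fin -powRrM -powRD; last by apply/implyP => _; rewrite lt0r_neq0.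
rewrite mulrBl [(_ * p)^-1]invfM -[_ / p * p]mulrA mulVf// mulr1.
by rewrite subrK.
Qed.

Lemma level_sumE (F : nat -> set (set T)) z (a : set T -> T -> R[i]) k x :
  finite_set (F k) ->
  level_sum F z a k x = \sum_(Q <- fset_set (F k)) z Q * a Q x.
Proof. by move=> finF; rewrite /level_sum fsbig_finite. Qed.

Lemma level_coefE (F : nat -> set (set T)) (z : set T -> R[i]) k :
  finite_set (F k) ->
  level_coef F p z k = \sum_(Q <- fset_set (F k)) Normc.normc (z Q) `^ p.
Proof. by move=> finF; rewrite /level_coef fsbig_finite. Qed.

Lemma level_coef_ge0 (F : nat -> set (set T)) (z : set T -> R[i]) k :
  0 <= level_coef F p z k.
Proof. by rewrite /level_coef; apply: sumr_ge0 => Q _; exact: powR_ge0. Qed.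

Lemma mesh_ge k Q : W k Q -> fine (m Q) <= mesh m W k.
Proof.
move=> WQ; apply: ub_le_sup; last by exists Q.
exists (fine (m setT)) => _ [Q' WQ' <-]; apply: fine_le.
- exact: grid_measure_fin WQ'.
- by rewrite ge0_fin_numE.
- have mQ' := grid_measurable gW WQ'.
  by apply: le_measure => //; rewrite inE.
Qed.

Lemma mesh_ge0 k : 0 <= mesh m W k.
Proof.
have [[Q WQ]|W0] := pselect (exists Q, W k Q).
  by apply: le_trans (mesh_ge WQ); exact: fine_ge0.
rewrite /mesh (_ : [set _ | _ in _] = set0) ?sup0//.
by apply/seteqP; split=> // x [Q WQ]; case: W0; exists Q.
Qed.

(** At almost every point at most [D] atoms of the level are non-zero, so the p-th power of the sum
    is at most D^p times the sum of the p-th powers; after integration each atom contributes at most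
    |Q|^(s p), which the mesh bounds. *)
Lemma level_qnorm_le (D : R) k (z : set T -> R[i]) (a : set T -> T -> R[i]) :
  1 <= D -> (forall x, (count (fun Q => `[< Q x >]) (fset_set (W k)))%:R <= D) ->
  (forall Q, W k Q -> atoms A Q (a Q)) ->
  cmeasurable (level_sum W z a k) /\
  (qnorm m p (level_sum W z a k) <=
   ((D * (mesh m W k `^ s * level_coef W p z k `^ p^-1)) `^ texp p)%:E)%E.
Proof.
move=> D1 cD atomsa; have finW := grid_finite gW k.
(* Nothing is known about [a] outside the level; zero values there make measurability hold for every
   index. *)
pose a' Q : T -> R[i] := if `[< W k Q >] then a Q else fun=> 0.
have -> : level_sum W z a k = (fun x => \sum_(Q <- fset_set (W k)) z Q * a' Q x).
  apply/funext => x; rewrite level_sumE// big_seq [RHS]big_seq.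
  by apply: eq_bigr => Q; rewrite (mem_level gW) /a' => ->.
have ma' Q : cmeasurable (a' Q).
  rewrite /a'; case: asboolP => WQ; last exact: cmeasurable_cst.
  exact: atom_cmeasurable WQ (atomsa _ WQ).
have mza Q : cmeasurable (fun x => z Q * a' Q x) by exact: cmeasurableZ.
have msum : cmeasurable (fun x => \sum_(Q <- fset_set (W k)) z Q * a' Q x).
  exact: cmeasurable_sum.
split=> //.
have D0 : 0 <= D by rewrite (le_trans ler01).
have M0 := mesh_ge0 k; have L0 := level_coef_ge0 W z k.
have Ib : (Lp_int m p (fun x => (\sum_(Q <- fset_set (W k)) z Q * a' Q x)%R) <=
    (D `^ p * (mesh m W k `^ (s * p) * level_coef W p z k))%:E)%E.
  apply: (@le_trans _ _ (\int[m]_x ((D `^ p)%:E * \sum_(Q <- fset_set (W k))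
      (Normc.normc (z Q * a' Q x) `^ p)%:E))%E).
    apply: ae_ge0_le_integral => //.
    - by move=> x _; rewrite lee_fin powR_ge0.
    - exact: measurable_normc_powR.
    - move=> x _; rewrite mule_ge0 ?lee_fin ?powR_ge0// sume_ge0// => Q _.
      by rewrite lee_fin powR_ge0.
    - apply: measurable_funeM; apply: emeasurable_sum => Q.
      exact: measurable_normc_powR.
    - have ae0 : {ae m, forall x, forall Q, Q \in fset_set (W k) -> ~ Q x -> a' Q x = 0}.
        apply: ae_all_seq => Q _; rewrite /a'; case: asboolP => WQ; last exact: nearW.
        exact: atom_vanishes WQ (atomsa _ WQ).
      apply: filterS ae0 => x xa _; rewrite sumEFin -EFinM lee_fin.
      have -> : \sum_(Q <- fset_set (W k)) z Q * a' Q x =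
          \sum_(Q <- fset_set (W k) | `[< Q x >]) z Q * a' Q x.
        rewrite [RHS]big_mkcond big_seq [RHS]big_seq; apply: eq_bigr => Q WQ.
        by case: asboolP => // /xa ->//; rewrite mulr0.
      apply: le_trans (ler_powR2r (ltW p0) (normc_ge0 _) (normc_sum_le _ _ _)) _.
      apply: le_trans (powR_sum_le_card p0 _ D1 (cD x)) _.
        by move=> Q _; exact: normc_ge0.
      rewrite ler_wpM2l ?powR_ge0// big_mkcond/=; apply: ler_sum => Q _.
      by case: ifP => // _; exact: powR_ge0.
  rewrite ge0_integralZl_EFin ?powR_ge0//; do ?[by move=> x _; apply: sume_ge0 => Q _;
    rewrite lee_fin powR_ge0 | by apply: emeasurable_sum => Q; exact: measurable_normc_powR].
  rewrite EFinM lee_wpmul2l ?lee_fin ?powR_ge0//.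
  rewrite ge0_integral_sum//; do ?[by move=> Q x _; rewrite lee_fin powR_ge0
    | by move=> Q; exact: measurable_normc_powR].
  rewrite level_coefE// mulr_sumr -sumEFin big_seq [leRHS]big_seq.
  apply: lee_sum => Q; rewrite (mem_level gW) => /asboolP WQ.
  under eq_integral do rewrite Normc.normcM powRM ?normc_ge0// EFinM.
  rewrite ge0_integralZl_EFin ?powR_ge0//; do ?[by move=> x _; rewrite lee_fin powR_ge0
    | exact: measurable_normc_powR].
  rewrite mulrC EFinM lee_wpmul2l ?lee_fin ?powR_ge0//.
  rewrite /a' asboolT//; apply: le_trans (atom_Lp_int WQ (atomsa _ WQ)) _.
  rewrite lee_fin; apply: ler_powR2r; [by rewrite mulr_ge0 ?ltW|exact: fine_ge0|].
  exact: mesh_ge.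
have tp0 : 0 < texp p / p by rewrite divr_gt0// texp_gt0.
rewrite qnormE; apply: le_trans (lee_poweR (ltW tp0) (Lp_int_ge0 _ _ _) Ib) _.
have -> : D `^ p * (mesh m W k `^ (s * p) * level_coef W p z k) =
    (D * (mesh m W k `^ s * level_coef W p z k `^ p^-1)) `^ p.
  by rewrite !powRM ?mulr_ge0 ?powR_ge0// powRVK ?lt0r_neq0// (powRrM _ s p).
have e : p * (texp p / p) = texp p by rewrite mulrCA mulfV ?mulr1// lt0r_neq0.
by rewrite poweR_EFin -powRrM e.
Qed.

(** Phases are absorbed by circledness, and moduli divided by their sum are the weights of a convex
    combination. The induction uses convexity for two atoms at a time, and non-emptiness of the set
    of atoms starts it. *)
Lemma atoms_comb k Q (I : eqType) (r : seq I) (c : I -> R[i])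
    (a : I -> T -> R[i]) : W k Q -> (forall j, j \in r -> atoms A Q (a j)) ->
  exists dd, atoms A Q dd /\ forall x, \sum_(j <- r) c j * a j x =
    (\sum_(j <- r) Normc.normc (c j))%:C%C * dd x.
Proof.
move=> WQ; elim: r => [|j r IH] ar.
  have [dd ddA] := atom_A3_nonempty aA WQ; exists dd; split=> // x.
  by rewrite !big_nil mul0r.
have {IH}[dd [ddA ddE]] : exists dd, atoms A Q dd /\ forall x,
    \sum_(j <- r) c j * a j x = (\sum_(j <- r) Normc.normc (c j))%:C%C * dd x.
  by apply: IH => i ir; apply: ar; rewrite in_cons ir orbT.
(* A zero coefficient has no phase and its atom is dropped; otherwise the total modulus is positive
   and can be divided by. *)
have [c0|c0] := eqVneq (c j) 0.
  exists dd; split=> // x; rewrite !big_cons c0 mul0r add0r ddE.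
  by rewrite Normc.normc0 add0r.
set N := \sum_(j <- r) _ in ddE.
have N0 : 0 <= N by apply: sumr_ge0 => i _; exact: normc_ge0.
set n := Normc.normc (c j).
have n0 : 0 < n.
  rewrite lt_neqAle normc_ge0 andbT eq_sym; apply: contra c0 => /eqP nc0.
  by apply/eqP; exact: Normc.eq0_normc nc0.
have nN0 : 0 < n + N by rewrite ltr_pwDl.
pose t := n / (n + N).
have t01 : 0 <= t <= 1.
  by rewrite /t divr_ge0 ?(ltW n0) ?(ltW nN0)//= ler_pdivrMr// mul1r lerDl.
have nC0 : (n%:C)%C != 0 by rewrite eq_complex/= negb_and lt0r_neq0.
have zeta1 : `|c j / (n%:C)%C| = 1.
  have normE (z : R[i]) : `|z| = ((Normc.normc z)%:C)%C by case: z.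
  by rewrite normE Normc.normcM Normc.normcV normc_real ?(ltW n0)// mulfV// lt0r_neq0.
have aj : atoms A Q (fun x => c j / (n%:C)%C * a j x).
  have [H _] := @atom_A3_circled _ _ _ _ _ _ _ _ _ aA _ _ WQ _ (a j) zeta1.
  by apply: H; apply: ar; rewrite mem_head.
exists (fun x => t%:C%C * (c j / (n%:C)%C * a j x) + (1 - t)%:C%C * dd x).
split; first exact: (atom_A3_convex aA WQ aj ddA t01).
move=> x; rewrite !big_cons ddE -/N -/n mulrDr !mulrA -!rmorphM/=.
have -> : (n + N) * t = n by rewrite /t mulrC divfK ?lt0r_neq0.
have -> : (n + N) * (1 - t) = N.
  by rewrite /t mulrBr mulr1 mulrC divfK ?lt0r_neq0// addrC addKr.
by congr (_ + _); rewrite [n%:C%C * c j]mulrC mulfK.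
Qed.

End atoms.

(** * Collecting the coefficients *)

Section quasinorm_scaling.
Context {d : measure_display} {T : measurableType d} {R : realType}.
Variable m : {measure set T -> \bar R}.
Variable p : R.
Hypothesis p0 : 0 < p.

Lemma qnormZ (z : R[i]) (f : T -> R[i]) : cmeasurable f ->
  qnorm m p (fun x => z * f x) = ((Normc.normc z `^ texp p)%:E * qnorm m p f)%E.
Proof.
move=> mf; have tp0 := texp_gt0 p0.
have -> : Normc.normc z `^ texp p = (Normc.normc z `^ p) `^ (texp p / p).
  by rewrite -powRrM; congr (_ `^ _); rewrite mulrCA mulfV ?mulr1// lt0r_neq0.
rewrite !qnormE -poweR_EFin -poweRM ?Lp_int_ge0 ?lee_fin ?powR_ge0//.
congr (_ `^ _)%E; rewrite -ge0_integralZl_EFin ?powR_ge0//.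
- by apply: eq_integral => x _; rewrite Normc.normcM powRM ?normc_ge0// EFinM.
- by move=> x _; rewrite lee_fin powR_ge0.
- exact: measurable_normc_powR.
Qed.

Lemma Lp_cvg_lincomb (I : eqType) (r : seq I) (z : I -> R[i])
    (S : I -> nat -> T -> R[i]) (h : I -> T -> R[i]) :
  (forall i n, i \in r -> cmeasurable (S i n)) ->
  (forall i, i \in r -> cmeasurable (h i)) ->
  (forall i, i \in r -> Lp_cvg m p%:E (S i) (h i)) ->
  Lp_cvg m p%:E (fun n x => \sum_(i <- r) z i * S i n x)
    (fun x => \sum_(i <- r) z i * h i x) /\
  cmeasurable (fun x => \sum_(i <- r) z i * h i x) /\
  forall n, cmeasurable (fun x => \sum_(i <- r) z i * S i n x).
Proof.
elim: r => [|i r IH] mS mh Sh.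
  split; last by split=> [|n]; under eq_fun do rewrite big_nil; exact: cmeasurable_cst.
  apply/Lp_cvgP => //.
  rewrite (_ : (fun n => _) = fun=> 0%E); first exact: cvg_cst.
  apply/funext => n; under [X in qnorm _ _ X]eq_fun do rewrite !big_nil subr0.
  exact: qnorm0.
have [] := IH.
- by move=> j n jr; apply: mS; rewrite in_cons jr orbT.
- by move=> j jr; apply: mh; rewrite in_cons jr orbT.
- by move=> j jr; apply: Sh; rewrite in_cons jr orbT.
move=> /(Lp_cvgP m p0) IHc [IHh IHS].
have mSi n : cmeasurable (S i n) by apply: mS; rewrite mem_head.
have mhi : cmeasurable (h i) by apply: mh; rewrite mem_head.
split; last first.
  split=> [|n].
    under eq_fun do rewrite big_cons.
    by apply: cmeasurableD => //; exact: cmeasurableZ.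
  under eq_fun do rewrite big_cons.
  by apply: cmeasurableD => //; exact: cmeasurableZ.
have /(Lp_cvgP m p0) Shi := Sh i (mem_head _ _).
apply/Lp_cvgP => //.
apply: (@le_cvge0 _ _ (fun n => (Normc.normc (z i) `^ texp p)%:E *
    qnorm m p (fun x => (S i n x - h i x)%R) +
    qnorm m p (fun x => (\sum_(i <- r) z i * S i n x - \sum_(i <- r) z i * h i x)%R))%E).
- by move=> n; exact: qnorm_ge0.
- move=> n; rewrite -qnormZ; last exact: cmeasurableB.
  under [X in (qnorm _ _ X <= _)%E]eq_fun do
    rewrite !big_cons opprD addrACA -mulrBr.
  apply: qnormD => //; last exact: cmeasurableB.
  by apply: cmeasurableZ; exact: cmeasurableB.
- apply: cvge0D => [n|n||//]; [|exact: qnorm_ge0|].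
    by rewrite mule_ge0 ?qnorm_ge0// lee_fin powR_ge0.
  apply: cvge0Z => //; [exact: powR_ge0|by move=> n; exact: qnorm_ge0].
Qed.

End quasinorm_scaling.

Section level_estimates.
Context {d : measure_display} {T : measurableType d} {R : realType}.
Variable m : {measure set T -> \bar R}.
Hypothesis mfin : (m setT < +oo)%E.
Variables (s p : R) (q : \bar R).
Hypothesis s0 : 0 < s.
Hypothesis p0 : 0 < p.
Hypothesis q0 : (0 < q)%E.
Variables (W G : nat -> set (set T)).
Hypothesis gW : is_grid m W.
Hypothesis gG : is_grid m G.

Lemma finite_inside Q k : finite_set (inside W Q k).
Proof. by apply: sub_finite_set (grid_finite gW k) => P []. Qed.

Lemma inside_sumE (V : zmodType) Q k (F : set T -> V) :
  \sum_(P <- fset_set (inside W Q k)) F P =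
  \sum_(P <- fset_set (W k) | `[< P `<=` Q >]) F P.
Proof.
rewrite -fsbig_finite; last exact: finite_inside.
rewrite (_ : inside W Q k = W k `&` [set P | P `<=` Q])//.
rewrite fsbig_mkcondr/= fsbig_finite; last exact: grid_finite gW k.
by rewrite [RHS]big_mkcond.
Qed.

Section level_bound.
Variables (kk : nat -> nat) (lambda C0 C1 : R).
Variables (sc : set T -> set T -> R[i]) (c : set T -> R[i]).
Hypothesis C00 : 0 <= C0.
Hypothesis lambda0 : 0 < lambda.
Hypothesis C11 : 1 <= C1.
Hypothesis cC1 : forall i x,
  (count (fun Q => `[< Q x >]) (fset_set (G i)))%:R <= C1.
Hypothesis sc_low : forall i Q k P, G i Q -> inside W Q k P -> (k < kk i)%N ->
  sc P Q = 0.
Hypothesis sc_le : forall i Q k, G i Q -> (kk i <= k)%N ->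
  level_coef (inside W Q) p (sc^~ Q) k <= C0 * lambda ^+ (k - kk i).

(** The share of level [i] of [G] in m_P, once the terms of all [Q] in G^i containing [P] are
    merged. *)
Definition pulled (P : set T) (i : nat) : R :=
  \sum_(Q <- fset_set (G i) | `[< P `<=` Q >]) Normc.normc (c Q * sc P Q).

Lemma pulled_ge0 P i : 0 <= pulled P i.
Proof. by apply: sumr_ge0 => Q _; exact: normc_ge0. Qed.

Lemma pulled_low k P i : W k P -> (k < kk i)%N -> pulled P i = 0.
Proof.
move=> WP ki; rewrite /pulled big_seq_cond big1// => Q /andP[].
rewrite (mem_level gG) => /asboolP GQ /asboolP PQ.
by rewrite (sc_low GQ _ ki) ?mulr0 ?Normc.normc0.
Qed.

(** The sets of G^i containing [P] share a point of [P], so there are at most [C1] of them.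
    Exchanging the sums over [P] and [Q] then lets the decay assumption act on each [Q]
    separately. *)
Lemma pulled_level_le i k :
  \sum_(P <- fset_set (W k)) pulled P i `^ p <=
  transfer p lambda C0 C1 kk (level_coef G p c) i k `^ p.
Proof.
have pn0 : p != 0 by rewrite lt0r_neq0.
rewrite /transfer; case: ifPn => ik; last first.
  rewrite big_seq big1 ?powR_ge0// => P; rewrite (mem_level gW) => /asboolP WP.
  by rewrite (pulled_low WP) ?powR0// ltnNge.
have C10 : 0 <= C1 by rewrite (le_trans ler01).
have L0 j := level_coef_ge0 p G c j.
have Cl0 : 0 <= C0 * lambda ^+ (k - kk i) by rewrite mulr_ge0 ?exprn_ge0 ?(ltW lambda0).
rewrite powRM ?powR_ge0// powRVK ?(mulr_ge0 Cl0 (L0 i))//.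
apply: (@le_trans _ _ (\sum_(P <- fset_set (W k)) C1 `^ p *
    \sum_(Q <- fset_set (G i) | `[< P `<=` Q >]) Normc.normc (c Q * sc P Q) `^ p)).
  rewrite big_seq [leRHS]big_seq; apply: ler_sum => P.
  rewrite (mem_level gW) => /asboolP WP.
  apply: powR_sum_le_card => // [Q _|]; first exact: normc_ge0.
  have [x Px] := grid_inhabited gW WP.
  apply: le_trans (cC1 i x); rewrite ler_nat; apply: sub_count => Q /= /asboolP PQ.
  by apply/asboolP; exact: PQ.
rewrite -mulr_sumr ler_wpM2l ?powR_ge0//.
under eq_bigr do rewrite big_mkcond/=.
rewrite exchange_big/= (level_coefE p c (grid_finite gG i)) mulr_sumr.
rewrite big_seq [leRHS]big_seq; apply: ler_sum => Q.
rewrite (mem_level gG) => /asboolP GQ; rewrite -big_mkcond/= mulrC.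
under eq_bigr do rewrite Normc.normcM powRM ?normc_ge0//.
rewrite -mulr_sumr ler_wpM2l ?powR_ge0//.
apply: le_trans (sc_le GQ ik).
by rewrite (level_coefE p _ (finite_inside Q k)) inside_sumE.
Qed.

End level_bound.

End level_estimates.

(** * Construction of the representation and bound on its cost *)

Section construction.
Context {d : measure_display} {T : measurableType d} {R : realType}.
Variable m : {measure set T -> \bar R}.
Hypothesis mfin : (m setT < +oo)%E.
Variables (s p : R) (q : \bar R).
Hypothesis s0 : 0 < s.
Hypothesis p0 : 0 < p.
Hypothesis q0 : (0 < q)%E.
Variables (W G : nat -> set (set T)).
Hypothesis gW : is_grid m W.
Hypothesis W1 : G1 (R := R) W.
Hypothesis W2 : G2 m s p q W.
Hypothesis gG : is_grid m G.
Hypothesis G1G : G1 (R := R) G.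
Variables (u2 : \bar R) (A2 : @atom_class d T R).
Hypothesis u21 : (1 <= u2)%E.
Hypothesis aA2 : is_atom_class m W s p u2 A2.
Variables (kk : nat -> nat) (alpha A B lambda C0 : R).
Hypothesis alpha0 : 0 < alpha.
Hypothesis hkk : forall i, alpha * i%:R + A <= (kk i)%:R <= alpha * i%:R + B.
Hypothesis lambda01 : 0 < lambda < 1.
Hypothesis C00 : 0 <= C0.

Local Notation K := (Kconst G p q alpha A B lambda C0).

Lemma Kconst_bound : exists r K0 C1 : R, [/\ 0 < r <= 1, r <= p, 1 <= C1 &
  [/\ 0 <= K0, K = K0%:E,
    forall i x, (count (fun Q => `[< Q x >]) (fset_set (G i)))%:R <= C1 &
    forall (L : nat -> R) (nn : nat -> nat), (forall i, 0 <= L i) ->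
      (lq_cost p q L < +oo)%E ->
      (lq_cost p q (fun k =>
        (\sum_(i < nn k) transfer p lambda C0 C1 kk L i k `^ r) `^ (p / r))%R <=
       K0%:E * lq_cost p q L)%E]].
Proof.
have [C1 [C1E C11 cC1]] := overlap_constP gG G1G.
have [r [r01 rp _ [K0 [K00 [KE HK]]]]] :=
  Kconst_transfer p0 alpha0 hkk lambda01 C00 (le_trans ler01 C11) q0.
by exists r, K0, C1; split=> //; split=> //; rewrite /Kconst C1E.
Qed.

Section family.
Variables (sc : set T -> set T -> R[i]) (b : set T -> set T -> T -> R[i]).
Variable h : set T -> T -> R[i].
Hypothesis htr : forall i Q, G i Q ->
  transmutes m p q W A2 kk lambda C0 i Q (sc^~ Q) (b^~ Q) (h Q).
Variable c : set T -> R[i].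
Hypothesis cfin : (cost G p q c < +oo)%E.

Local Notation y := (pulled G sc c).

Lemma transmutes_atom i Q k P : G i Q -> inside W Q k P -> atoms A2 P (b P Q).
Proof. by move=> /htr[rep _ _] PQ; exact: (rep_atoms rep PQ). Qed.

(** Terms are merged within one level of [G] before the levels are added: the pieces indexed by
    pairs of levels must themselves be combinations of atoms for their quasi-norms to be
    estimated. *)
Lemma pulled_atoms : exists dd : set T -> nat -> T -> R[i],
  forall k P i, W k P -> atoms A2 P (dd P i) /\
    forall x, \sum_(Q <- fset_set (G i) | `[< P `<=` Q >]) c Q * sc P Q * b P Q x =
      (y P i)%:C%C * dd P i x.
Proof.
have H (Pi : set T * nat) : exists dd : T -> R[i], forall k, W k Pi.1 ->
    atoms A2 Pi.1 dd /\ forall x,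
    \sum_(Q <- fset_set (G Pi.2) | `[< Pi.1 `<=` Q >]) c Q * sc Pi.1 Q * b Pi.1 Q x =
      (y Pi.1 Pi.2)%:C%C * dd x.
  case: Pi => P i /=; have [[k WP]|nW] := pselect (exists k, W k P); last first.
    by exists (fun=> 0) => k WP; case: nW; exists k.
  have ab Q : Q \in [seq Q <- fset_set (G i) | `[< P `<=` Q >]] -> atoms A2 P (b P Q).
    rewrite mem_filter (mem_level gG) => /andP[/asboolP PQ /asboolP GQ].
    exact: (transmutes_atom GQ (conj WP PQ)).
  have [dd [ddA ddE]] := atoms_comb aA2 (fun Q => c Q * sc P Q) WP ab.
  exists dd => _ _; split=> // x.
  by have := ddE x; rewrite !big_filter.
have [dd ddP] := choice H; exists (fun P i => dd (P, i)) => k P i WP.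
exact: (ddP (P, i) k WP).
Qed.

(** Distinct levels share no set, so [P] determines its level. The coefficient and the atom can thus
    be functions of [P] alone, although the number of terms collected at [P] depends on the
    level. *)
Lemma grid_level : exists lev : set T -> nat, forall k P, W k P -> lev P = k.
Proof.
have [lev levP] : {lev : set T -> nat & forall P k, W k P -> lev P = k}.
  apply: (@choice _ _ (fun P k0 => forall k, W k P -> k0 = k)) => P.
  have [[k WP]|nW] := pselect (exists k, W k P); last first.
    by exists 0%N => k WP; case: nW; exists k.
  by exists k => k'; exact: (grid_distinct gW WP).
by exists lev => k P; exact: levP.
Qed.

Lemma used_W k : used G W sc k `<=` W k.
Proof. by move=> P [i [Q [_ []]]]. Qed.

(** More than part A is recorded: the representation over the whole of [W] is what membership in the
    space and part C require, and the finite expansion of [mu P * delta P] is what positivity is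
    read off from. *)
Lemma transmute_exists : exists g mu delta,
  [/\ transmuted m p q G W A2 K sc h c g mu delta,
  is_representation m p q A2 W mu delta g,
  (cost W p q mu <= K * cost G p q c)%E &
  forall k P, W k P -> exists n : nat,
    (forall x, mu P * delta P x = \sum_(i < n)
       \sum_(Q <- fset_set (G i) | `[< P `<=` Q >]) c Q * sc P Q * b P Q x) /\
    mu P = (\sum_(i < n) y P i)%:C%C].
Proof.
have [r [K0 [C1 [r01 rp C11 [K00 KE cC1 HK]]]]] := Kconst_bound.
have [r0 r1] := andP r01; have [l0 _] := andP lambda01.
have C10 : 0 <= C1 by rewrite (le_trans ler01).
have [D [_ D1 cD]] := overlap_constP gW W1.
have D0 : 0 <= D by rewrite (le_trans ler01).
have t0 := texp_gt0 p0.
pose L := level_coef G p c.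
have L0 i : 0 <= L i := level_coef_ge0 p G c i.
have [nn nnP] := transfer_cutoff alpha0 hkk.
have [dd ddP] := pulled_atoms.
have [lev levP] := grid_level.
pose u := transfer p lambda C0 C1 kk L.
have u0 i k : 0 <= u i k by exact: transfer_ge0.
have sc_low i Q k P : G i Q -> inside W Q k P -> (k < kk i)%N -> sc P Q = 0.
  by move=> /htr[_ low _] PQ; exact: low PQ.
have sc_le i Q k : G i Q -> (kk i <= k)%N ->
    level_coef (inside W Q) p (sc^~ Q) k <= C0 * lambda ^+ (k - kk i).
  by move=> /htr[_ _]; apply.
have y0 P i : 0 <= y P i := pulled_ge0 G sc c P i.
have ylow k P i : W k P -> (k < kk i)%N -> y P i = 0.
  exact: (pulled_low gG c sc_low).
have yu i k : \sum_(P <- fset_set (W k)) y P i `^ p <= u i k `^ p.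
  exact: (pulled_level_le p0 gW gG c C00 l0 C11 cC1 sc_low sc_le).
(* Levels [i >= nn k] contribute nothing at level [k] of [W], so this finite sum is the full
   coefficient. *)
pose mu P : R[i] := (\sum_(i < nn (lev P)) y P i)%:C%C.
have [delta deltaP] : exists delta : set T -> T -> R[i], forall P k, W k P ->
    atoms A2 P (delta P) /\ forall x,
    \sum_(i < nn k) (y P i)%:C%C * dd P i x = (\sum_(i < nn k) y P i)%:C%C * delta P x.
  suff /choice[delta dP] : forall P, exists de : T -> R[i], forall k, W k P ->
      atoms A2 P de /\ forall x,
      \sum_(i < nn k) (y P i)%:C%C * dd P i x = (\sum_(i < nn k) y P i)%:C%C * de x.
    by exists delta.
  move=> P; have [[k WP]|nW] := pselect (exists k, W k P); last first.
    by exists (fun=> 0) => k WP; case: nW; exists k.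
  have aP (i : 'I_(nn k)) : i \in index_enum 'I_(nn k) -> atoms A2 P (dd P i).
    by move=> _; have [] := ddP k P i WP.
  have [de [deA deE]] := atoms_comb aA2 (fun i : 'I_(nn k) => (y P i)%:C%C) WP aP.
  exists de => k' /(grid_distinct gW WP) <-; split=> // x.
  by rewrite deE; congr (_%:C%C * _); apply: eq_bigr => i _; rewrite normc_real.
have muE k P : W k P -> mu P = (\sum_(i < nn k) y P i)%:C%C.
  by move=> /levP <-.
(* The part of the i-th sum of the c_Q h_Q that is carried by level [k] of [W]. *)
pose f i k := level_sum W (fun P => (y P i)%:C%C) (dd^~ i) k.
have fE i k x : f i k x = \sum_(P <- fset_set (W k)) (y P i)%:C%C * dd P i x.
  exact: level_sumE (grid_finite gW k).
have fcoef i k : level_coef W p (fun P => (y P i)%:C%C) k =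
    \sum_(P <- fset_set (W k)) y P i `^ p.
  rewrite (level_coefE _ _ (grid_finite gW k)).
  by apply: eq_bigr => P _; rewrite normc_real.
have fq i k : cmeasurable (f i k) /\
    (qnorm m p (f i k) <= ((D * (mesh m W k `^ s * u i k)) `^ texp p)%:E)%E.
  have [mf qf] := level_qnorm_le mfin p0 s0 u21 gW aA2 (fun P => (y P i)%:C%C) D1
    (cD k) (fun P WP => (ddP k P i WP).1).
  split=> //; apply: le_trans qf _; rewrite lee_fin fcoef.
  apply: ler_powR2r; rewrite ?(ltW t0) ?mulr_ge0 ?powR_ge0//.
  rewrite !ler_wpM2l ?powR_ge0// -[leRHS](powRK (lt0r_neq0 p0))//.
  rewrite ler_powR2r ?invr_ge0 ?(ltW p0)//.
  by apply: sumr_ge0 => P _; exact: powR_ge0.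
have f0 i k x : (nn k <= i)%N -> f i k x = 0.
  move=> /nnP ki; rewrite fE big_seq big1// => P; rewrite (mem_level gW) => /asboolP WP.
  by rewrite (ylow k P i WP ki) mul0r.
(* A bound, as a p-th power, for the coefficients collected at level [k]; its cost is at most [K]
   times that of [c]. *)
pose Z k := (\sum_(i < nn k) u i k `^ r) `^ (p / r).
have Zfin : (lq_cost p q Z < +oo)%E.
  apply: le_lt_trans (HK L nn L0 cfin) _.
  have cfin' : cost G p q c \is a fin_num by rewrite ge0_fin_numE// lq_cost_ge0.
  by rewrite -[lq_cost p q L]/(cost G p q c) -(fineK cfin') -EFinM ltry.
have rt : r <= texp p.
  by have [p1|p1] := leP 1 p; [rewrite texp_ge1|rewrite texp_lt1].
(* The cost bound uses the exponent [r], the L^p estimates use t = min(1, p) >= r. The power r/t <=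
   1 is subadditive, so the l^t norm in [i] is at most the l^r norm. *)
have ut k : \sum_(i < nn k) u i k `^ texp p <= (Z k `^ p^-1) `^ texp p.
  have tr1 : 0 < r / texp p <= 1.
    by rewrite divr_gt0//= ler_pdivrMr// mul1r.
  have := @powR_sum_le R _ (index_enum 'I_(nn k)) xpredT (r / texp p)
    (fun i => u i k `^ texp p) tr1 (fun i _ => powR_ge0 _ _).
  under [X in _ <= X -> _]eq_bigr do
    rewrite -powRrM mulrC divfK ?lt0r_neq0//.
  have tr0 : 0 <= texp p / r by rewrite divr_ge0 ?ltW.
  move=> /(ler_powR2r tr0 (powR_ge0 _ _)).
  rewrite -powRrM; have -> : r / texp p * (texp p / r) = 1.
    by rewrite mulrA divfK ?divff ?lt0r_neq0.
  rewrite powRr1; last first.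
    by apply: sumr_ge0 => i _; exact: powR_ge0.
  move=> /le_trans; apply; rewrite le_eqVlt; apply/orP; left; apply/eqP.
  by rewrite /Z -!powRrM; congr (_ `^ _); field; rewrite !lt0r_neq0.
(* Here (G2), paired with the finite cost of [Z], gives the absolute summability of the double
   series. *)
have fsum : (\sum_(0 <= k <oo) \sum_(i < nn k) qnorm m p (f i k) < +oo)%E.
  have Gfin := Gamma_summable p0 q0 (mesh_ge0 mfin gW) (fun k => powR_ge0 _ _ : 0 <= Z k)
    W2.1 Zfin.
  apply: (@le_lt_trans _ _ ((D `^ texp p)%:E * \sum_(0 <= k <oo)
    ((mesh m W k `^ s * Z k `^ p^-1) `^ texp p)%R%:E)%E); last first.
    by apply: lte_mul_pinfty; rewrite ?lee_fin ?powR_ge0.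
  rewrite -nneseriesZl => [|k _]; last by rewrite lee_fin powR_ge0.
  apply: lee_nneseries => [k _ _|k _].
    by apply: sume_ge0 => i _; exact: qnorm_ge0.
  apply: (@le_trans _ _ (\sum_(i < nn k) ((D * (mesh m W k `^ s * u i k)) `^ texp p)%:E)%E).
    by apply: lee_sum => i _; have [] := fq i k.
  rewrite sumEFin -EFinM lee_fin.
  under eq_bigr do rewrite !powRM ?mulr_ge0 ?powR_ge0//.
  rewrite -!mulr_sumr ler_wpM2l ?powR_ge0// powRM ?powR_ge0// ler_wpM2l ?powR_ge0//.
pose S i x := \sum_(Q <- fset_set (G i)) c Q * h Q x.
pose part Q n x := \sum_(k < n) level_sum (inside W Q) (sc^~ Q) (b^~ Q) k x.
have mpart i Q n : G i Q -> cmeasurable (part Q n).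
  move=> GQ; apply: cmeasurable_sum => k.
  have -> : level_sum (inside W Q) (sc^~ Q) (b^~ Q) k = (fun x =>
      \sum_(P <- fset_set (inside W Q k)) sc P Q * b P Q x).
    by apply/funext => x; rewrite (level_sumE _ _ _ (finite_inside gW Q k)).
  apply: cmeasurable_sum_in => P.
  rewrite in_fset_set ?inE; last exact: finite_inside gW Q k.
  move=> PQ; apply: cmeasurableZ.
  exact: (atom_cmeasurable aA2 PQ.1 (transmutes_atom GQ PQ)).
(* Both sides are one finite double sum over [P] and [Q], so the [f i k] add up in [k] to
   combinations of partial expansions of the h_Q, whose limits are known. *)
have partE i n x : \sum_(k < n) f i k x =
    \sum_(Q <- fset_set (G i)) c Q * part Q n x.
  under [RHS]eq_bigr do rewrite mulr_sumr.
  rewrite [RHS]exchange_big/=; apply: eq_bigr => k _; rewrite fE.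
  transitivity (\sum_(P <- fset_set (W k)) \sum_(Q <- fset_set (G i))
      if `[< P `<=` Q >] then c Q * sc P Q * b P Q x else 0).
    rewrite big_seq [RHS]big_seq; apply: eq_bigr => P.
    rewrite (mem_level gW) => /asboolP WP.
    by rewrite -(ddP k P i WP).2 big_mkcond.
  rewrite exchange_big/=; apply: eq_bigr => Q _.
  rewrite (level_sumE _ _ _ (finite_inside gW Q k)) (inside_sumE gW) mulr_sumr.
  by rewrite -big_mkcond/=; apply: eq_bigr => P _; rewrite mulrA.
have Slim i : Lp_cvg m p%:E (fun n x => \sum_(k < n) f i k x) (S i) /\ cmeasurable (S i).
  have [|Q|Q|cv [mS _]] := @Lp_cvg_lincomb _ _ _ m p p0 _ (fset_set (G i)) c part h.
  - by move=> Q n; rewrite (mem_level gG) => /asboolP; exact: mpart.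
  - by rewrite (mem_level gG) => /asboolP /htr[rep _ _]; case: (rep_Lp rep).
  - by rewrite (mem_level gG) => /asboolP /htr[rep _ _]; exact: (rep_cvg rep).
  split; last exact: mS.
  have SE : (fun n x => \sum_(Q <- fset_set (G i)) c Q * part Q n x) =
      (fun n x => \sum_(k < n) f i k x).
    by apply/funext => n; apply/funext => x; rewrite partE.
  exact: (eq_ind _ (fun F => Lp_cvg m p%:E F (S i)) cv _ SE).
have [g [Lg Labs Lc Sc]] := Lp_double_series p0 (fun i k => (fq i k).1)
  (fun i => (Slim i).2) f0 fsum (fun i => (Slim i).1).
have levelE k x : level_sum W mu delta k x = \sum_(i < nn k) f i k x.
  rewrite (level_sumE _ _ _ (grid_finite gW k)).
  under [RHS]eq_bigr do rewrite fE.
  rewrite exchange_big/= big_seq [RHS]big_seq; apply: eq_bigr => P.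
  rewrite (mem_level gW) => /asboolP WP.
  by rewrite (deltaP P k WP).2 (muE k P WP).
have coefE k : level_coef W p mu k = \sum_(P <- fset_set (W k)) (\sum_(i < nn k) y P i) `^ p.
  rewrite (level_coefE _ _ (grid_finite gW k)) big_seq [RHS]big_seq.
  apply: eq_bigr => P; rewrite (mem_level gW) => /asboolP WP.
  by rewrite (muE k P WP) normc_real ?sumr_ge0.
have costW : (cost W p q mu <= K * cost G p q c)%E.
  rewrite KE; apply: le_trans (HK L nn L0 cfin).
  apply: (le_lq_cost p0 q0) => k; rewrite level_coef_ge0/= coefE.
  exact: (quasi_minkowski_sum _ r01 rp).
(* Sets of [W] outside H^k have s_{P,Q} = 0 for every [Q] containing them and so carry a zero
   coefficient: sums over [W] and over H^k agree. *)
have mu_unused k P : (W k `\` used G W sc k) P -> mu P = 0.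
  move=> [WP nP]; rewrite (muE k P WP) big1// => i _.
  rewrite /pulled big_seq_cond big1// => Q /andP[].
  rewrite (mem_level gG) => /asboolP GQ /asboolP PQ.
  suff -> : sc P Q = 0 by rewrite mulr0 Normc.normc0.
  by apply/eqP/negP => /negP scn0; apply: nP; exists i, Q.
have usedE k x : level_sum (used G W sc) mu delta k x = level_sum W mu delta k x.
  apply: fsbig_widen => [|P /mu_unused muP]; first exact: used_W.
  by change (mu P * delta P x = 0); rewrite muP mul0r.
have usedcE k : level_coef (used G W sc) p mu k = level_coef W p mu k.
  apply: fsbig_widen => [|P /mu_unused muP]; first exact: used_W.
  by change (Normc.normc (mu P) `^ p = 0); rewrite muP Normc.normc0 powR0 ?lt0r_neq0.
have usedW k : level_sum (used G W sc) mu delta k = level_sum W mu delta k.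
  by apply/funext => x; exact: usedE.
have Wsum k : level_sum W mu delta k = (fun x => \sum_(i < nn k) f i k x).
  by apply/funext => x; exact: levelE.
have repW : is_representation m p q A2 W mu delta g.
  apply: IsRepresentation.
  - exact: Lg.
  - by move=> k P WP; have [] := deltaP P k WP.
  - by under eq_eseriesr do rewrite Wsum.
  - apply: le_lt_trans costW _; rewrite KE.
    have cfin' : cost G p q c \is a fin_num by rewrite ge0_fin_numE// lq_cost_ge0.
    by rewrite -(fineK cfin') -EFinM ltry.
  - have SE : (fun n x => \sum_(k < n) \sum_(i < nn k) f i k x) =
        (fun N x => \sum_(k < N) level_sum W mu delta k x).
      by apply/funext => n; apply/funext => x; apply: eq_bigr => k _; rewrite levelE.
    exact: (eq_ind _ (fun F => Lp_cvg m p%:E F g) Lc _ SE).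
have costE : cost (used G W sc) p q mu = cost W p q mu.
  by rewrite /cost (_ : level_coef (used G W sc) p mu = level_coef W p mu)//; exact/funext.
exists g, mu, delta; split; [|exact: repW|exact: costW|]; last first.
  move=> k P WP; exists (nn k); split; last exact: muE.
  move=> x; rewrite (muE k P WP) -(deltaP P k WP).2; apply: eq_bigr => i _.
  by rewrite (ddP k P i WP).2.
split.
- have SE : (fun n x => \sum_(i < n.+1) S i x) =
      (fun N x => \sum_(i < N.+1) \sum_(Q \in G i) c Q * h Q x).
    apply/funext => n; apply/funext => x; apply: eq_bigr => i _.
    exact: esym (fsbig_finite _ _ (grid_finite gG i)).
  exact: (eq_ind _ (fun F => Lp_cvg m p%:E F g) Sc _ SE).
- by exists mu, delta.
- case: repW => LW aW absW costfW cvgW; apply: IsRepresentation.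
  + exact: LW.
  + by move=> k P /used_W; exact: aW.
  + by under eq_eseriesr do rewrite usedW.
  + by rewrite costE; exact: costfW.
  + have SE : (fun N x => \sum_(k < N) level_sum W mu delta k x) =
        (fun N x => \sum_(k < N) level_sum (used G W sc) mu delta k x).
      by apply/funext => n; apply/funext => x; apply: eq_bigr => k _; rewrite usedE.
    exact: (eq_ind _ (fun F => Lp_cvg m p%:E F g) cvgW _ SE).
- by move=> k P _; rewrite /mu -(rmorph0 (real_complex R)) lecR sumr_ge0.
- by rewrite costE; exact: costW.
Qed.

End family.
End construction.

(** * Positivity *)

Section positive_sums.
Context {V : numDomainType} {I : eqType}.

Lemma term_le_sum (r : seq I) (P : pred I) (F : I -> V) j :
  (forall i, i \in r -> P i -> 0 <= F i) -> j \in r -> P j ->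
  F j <= \sum_(i <- r | P i) F i.
Proof.
move=> F0 jr Pj; rewrite (big_rem j jr)/= Pj lerDl big_seq_cond.
by apply: sumr_ge0 => i /andP[/mem_rem ir Pi]; exact: F0.
Qed.

Lemma sum_ge0_in (r : seq I) (P : pred I) (F : I -> V) :
  (forall i, i \in r -> P i -> 0 <= F i) -> 0 <= \sum_(i <- r | P i) F i.
Proof.
by move=> F0; rewrite big_seq_cond; apply: sumr_ge0 => i /andP[ir Pi]; exact: F0.
Qed.

End positive_sums.

Section limits_in_Lp.
Context {d : measure_display} {T : measurableType d} {R : realType}.
Variable m : {measure set T -> \bar R}.
Variable p : R.
Hypothesis p0 : 0 < p.

Lemma qnorm0_eq0 (f : T -> R[i]) : cmeasurable f -> qnorm m p f = 0%E ->
  {ae m, forall x, f x = 0}.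
Proof.
move=> mf qf; have t0 := texp_gt0 p0.
have : cnorm m p%:E f = 0%E by rewrite cnorm_qnorm// qf poweR0r// invr_neq0// lt0r_neq0.
have mn : measurable_fun setT (fun x => (Normc.normc (f x))%:E).
  by apply/measurable_EFinP; exact: cmeasurable_normc.
have p0E : (0 < p%:E)%E by rewrite lte_fin.
move=> /(Lnorm_eq0_eq0 mn p0E); apply: filterS => x /= /(_ I) [] fx0.
exact: Normc.eq0_normc fx0.
Qed.

(** The positive part of v - Re h is dominated by |f_n - h| for large n, hence has quasi-norm zero;
    no almost everywhere convergent subsequence has to be extracted. *)
Lemma Lp_limit_ge (f : nat -> T -> R[i]) (h : T -> R[i]) (v : T -> R) (N0 : nat) :
  (forall n, cmeasurable (f n)) -> cmeasurable h -> measurable_fun setT v ->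
  (forall n, (N0 <= n)%N -> {ae m, forall x, v x <= complex.Re (f n x)}) ->
  Lp_cvg m p%:E f h -> {ae m, forall x, v x <= complex.Re (h x)}.
Proof.
move=> mf mh mv vf /(Lp_cvgP m p0) fh.
pose w x : R[i] := (Num.max (v x - complex.Re (h x)) 0)%:C%C.
have mw : cmeasurable w.
  split; last exact: measurable_cst.
  apply: measurable_maxr; last exact: measurable_cst.
  by apply: measurable_funB => //; case: mh.
have qw : qnorm m p w = 0%E.
  apply/eqP; rewrite eq_le qnorm_ge0 andbT.
  apply: (@lee_add_cvge0 _ _ 0%E (fun n => qnorm m p (fun x => (f (n + N0)%N x - h x)%R))).
  - by move=> n; exact: qnorm_ge0.
  - by rewrite (cvg_shiftn N0 (fun n => qnorm m p (fun x => (f n x - h x)%R)) _).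
  - move=> n; rewrite add0e; apply: qnorm_le => //; first exact: cmeasurableB.
    apply: filterS (vf _ (leq_addl n N0)) => x vx.
    rewrite normc_real ?le_max ?lexx ?orbT// ge_max normc_ge0 andbT.
    apply: le_trans (Re_le_normc _); apply: le_trans (ler_norm _).
    by rewrite ReD ReN lerD2r.
apply: filterS (qnorm0_eq0 mw qw) => x /(congr1 (@complex.Re R))/= wx.
by rewrite -subr_le0 -wx le_max lexx.
Qed.

Lemma Lp_cvg_unique (f : nat -> T -> R[i]) (g h : T -> R[i]) :
  (forall n, cmeasurable (f n)) -> cmeasurable g -> cmeasurable h ->
  Lp_cvg m p%:E f g -> Lp_cvg m p%:E f h -> qnorm m p (fun x => g x - h x) = 0%E.
Proof.
move=> mf mg mh /(Lp_cvgP m p0) fg /(Lp_cvgP m p0) fh.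
apply/eqP; rewrite eq_le qnorm_ge0 andbT.
apply: (@lee_add_cvge0 _ _ 0%E (fun n => qnorm m p (fun x => (f n x - g x)%R) +
    qnorm m p (fun x => (f n x - h x)%R))%E).
- by move=> n; rewrite adde_ge0 ?qnorm_ge0.
- by apply: cvge0D => // n; exact: qnorm_ge0.
move=> n; rewrite add0e.
have -> : qnorm m p (fun x => f n x - g x) = qnorm m p (fun x => g x - f n x).
  by rewrite -qnormN//; under eq_fun do rewrite opprB.
exact: qnormB.
Qed.

Lemma Lp_cvg_eq (f : nat -> T -> R[i]) (g h : T -> R[i]) :
  (forall n, cmeasurable (f n)) -> cmeasurable g -> cmeasurable h ->
  Lp_cvg m p%:E f g -> qnorm m p (fun x => g x - h x) = 0%E -> Lp_cvg m p%:E f h.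
Proof.
move=> mf mg mh /(Lp_cvgP m p0) fg gh; apply/Lp_cvgP => //.
apply: le_cvge0 fg => n; first exact: qnorm_ge0.
by rewrite -[leRHS]adde0 -gh; exact: qnormB.
Qed.

Lemma level_sum_cmeasurable (F : nat -> set (set T)) z (a : set T -> T -> R[i]) k :
  finite_set (F k) -> (forall Q, F k Q -> cmeasurable (a Q)) ->
  cmeasurable (level_sum F z a k).
Proof.
move=> finF ma; have -> : level_sum F z a k = (fun x =>
    \sum_(Q <- fset_set (F k)) z Q * a Q x).
  by apply/funext => x; exact: level_sumE.
apply: cmeasurable_sum_in => Q; rewrite in_fset_set ?inE// => FQ.
by apply: cmeasurableZ; exact: ma.
Qed.

End limits_in_Lp.

Section consequences.
Context {d : measure_display} {T : measurableType d} {R : realType}.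
Variable m : {measure set T -> \bar R}.
Hypothesis mfin : (m setT < +oo)%E.
Variables (s p : R) (q : \bar R).
Hypothesis s0 : 0 < s.
Hypothesis p0 : 0 < p.
Hypothesis q0 : (0 < q)%E.
Variables (W G : nat -> set (set T)).
Hypothesis gW : is_grid m W.
Hypothesis W1 : G1 (R := R) W.
Hypothesis W2 : G2 m s p q W.
Hypothesis gG : is_grid m G.
Hypothesis G1G : G1 (R := R) G.
Variables (u2 : \bar R) (A2 : @atom_class d T R).
Hypothesis u21 : (1 <= u2)%E.
Hypothesis aA2 : is_atom_class m W s p u2 A2.
Variables (kk : nat -> nat) (alpha A B lambda C0 : R).
Hypothesis alpha0 : 0 < alpha.
Hypothesis hkk : forall i, alpha * i%:R + A <= (kk i)%:R <= alpha * i%:R + B.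
Hypothesis lambda01 : 0 < lambda < 1.
Hypothesis C00 : 0 <= C0.

Local Notation K := (Kconst G p q alpha A B lambda C0).

Section positivity.
Variables (sc : set T -> set T -> R[i]) (b : set T -> set T -> T -> R[i]).
Variable h : set T -> T -> R[i].
Hypothesis htr : forall i Q, G i Q ->
  transmutes m p q W A2 kk lambda C0 i Q (sc^~ Q) (b^~ Q) (h Q).
Hypothesis hpos : forall i Q k P, G i Q -> inside W Q k P ->
  0 <= sc P Q /\ {ae m, forall x, P x -> 0 < b P Q x}.

(** The terms of the expansion of h_Q are non-negative almost everywhere, so partial sums that
    contain the term of [P] stay above it; this lower bound survives the limit in L^p and is
    positive on [P]. *)
Lemma transmuted_support i Q k P : G i Q -> inside W Q k P -> 0 < sc P Q ->
  {ae m, forall x, P x -> h Q x != 0}.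
Proof.
move=> GQ PQ scP.
have [rep _ _] := htr GQ; have [mh _] := rep_Lp rep.
have term_ge0 k' P' : inside W Q k' P' -> {ae m, forall x, 0 <= sc P' Q * b P' Q x}.
  move=> PQ'; have [sc0 bpos] := hpos GQ PQ'.
  have bvan := atom_vanishes aA2 PQ'.1 (transmutes_atom htr GQ PQ').
  apply: filterS2 bpos bvan => x bp bv.
  have [Px|nPx] := pselect (P' x); first by rewrite mulr_ge0// ltW// bp.
  by rewrite bv// mulr0.
have mb k' P' : inside W Q k' P' -> cmeasurable (b P' Q).
  by move=> PQ'; exact: (atom_cmeasurable aA2 PQ'.1 (transmutes_atom htr GQ PQ')).
have mpart n : cmeasurable (fun x => \sum_(k < n) level_sum (inside W Q) (sc^~ Q) (b^~ Q) k x).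
  apply: cmeasurable_sum => k'; apply: level_sum_cmeasurable.
    exact: finite_inside gW Q k'.
  by move=> P'; exact: mb.
have [_ bP] := hpos GQ PQ.
have mv : measurable_fun setT (fun x => complex.Re (sc P Q * b P Q x)).
  by case: (cmeasurableZ (sc P Q) (mb k P PQ)).
(* Level [k] occurs in the partial sums from length [k + 1] on. *)
have := @Lp_limit_ge _ _ _ m p p0 _ (h Q) _ k.+1 mpart mh mv _ (rep_cvg rep).
move=> H; have {}H : {ae m, forall x, complex.Re (sc P Q * b P Q x) <= complex.Re (h Q x)}.
  apply: H => n kn.
  have : {ae m, forall x, forall k', k' \in iota 0 n -> forall P',
      P' \in fset_set (inside W Q k') -> 0 <= sc P' Q * b P' Q x}.
    apply: ae_all_seq => k' _; apply: ae_all_seq => P'.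
    by rewrite in_fset_set ?inE; [exact: term_ge0|exact: finite_inside gW Q k'].
  apply: filterS => x tx.
  suff : sc P Q * b P Q x <= \sum_(k < n) level_sum (inside W Q) (sc^~ Q) (b^~ Q) k x.
    by rewrite lecE => /andP[].
  have lvl k' : level_sum (inside W Q) (sc^~ Q) (b^~ Q) k' x =
      \sum_(P' <- fset_set (inside W Q k')) sc P' Q * b P' Q x.
    by rewrite (level_sumE _ _ _ (finite_inside gW Q k')).
  rewrite -(big_mkord xpredT (fun k => level_sum (inside W Q) (sc^~ Q) (b^~ Q) k x)).
  rewrite /index_iota subn0.
  apply: (@le_trans _ _ (level_sum (inside W Q) (sc^~ Q) (b^~ Q) k x)).
    rewrite lvl; apply: (term_le_sum (F := fun P' => sc P' Q * b P' Q x)) => //.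
      by move=> P' P'k _; apply: (tx k); rewrite ?mem_iota.
    by rewrite in_fset_set ?inE; [|exact: finite_inside gW Q k].
  apply: (term_le_sum (F := fun k => level_sum (inside W Q) (sc^~ Q) (b^~ Q) k x)) => //.
    by move=> k' k'n _; rewrite lvl; apply: sum_ge0_in => P' P'k _; exact: tx k'n _ _.
  by rewrite mem_iota.
apply: filterS2 H bP => x Hx bx Px; apply/eqP => hx0.
have : 0 < sc P Q * b P Q x by rewrite mulr_gt0// bx.
by rewrite ltcE/= => /andP[_]; apply/negP; rewrite -leNgt (le_trans Hx)// hx0.
Qed.

(** A non-zero [mu] forces some c_Q s_{P,Q} != 0 in its expansion, which provides [Q]. When the c_Q
    are non-negative, mu delta is a sum of terms non-negative on [P], the one from this [Q] being
    positive, and dividing by mu > 0 gives the sign of [delta]. *)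
Lemma transmuted_positive (c : set T -> R[i]) (mu : R[i]) (delta : T -> R[i])
    k P (n : nat) : W k P ->
  (forall x, mu * delta x = \sum_(i < n)
     \sum_(Q <- fset_set (G i) | `[< P `<=` Q >]) c Q * sc P Q * b P Q x) ->
  mu = (\sum_(i < n) pulled G sc c P i)%:C%C -> mu != 0 ->
  (exists i Q, [/\ G i Q, inside W Q k P, c Q != 0, 0 < sc P Q
     & {ae m, forall x, P x -> h Q x != 0}]) /\
  ((forall i Q, G i Q -> 0 <= c Q) -> {ae m, forall x, P x -> 0 < delta x}).
Proof.
move=> WP deltaE muE mun0.
have [i [Q [GQ PQ ni cQ scP]]] : exists i Q, [/\ G i Q, inside W Q k P, (i < n)%N,
    c Q != 0 & 0 < sc P Q].
  apply: contrapT => H; move/eqP: mun0; apply; rewrite muE big1// => i _.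
  rewrite /pulled big_seq_cond big1// => Q /andP[].
  rewrite (mem_level gG) => /asboolP GQ /asboolP PQ.
  have [->|cQ] := eqVneq (c Q) 0; first by rewrite mul0r Normc.normc0.
  have [->|scQ] := eqVneq (sc P Q) 0; first by rewrite mulr0 Normc.normc0.
  case: H; exists i, Q; split=> //.
  by rewrite lt_def scQ /=; case: (hpos GQ (conj WP PQ : inside W Q k P)).
split.
  by exists i, Q; split=> //; exact: (transmuted_support GQ PQ scP).
move=> c0.
have mu0 : 0 < mu.
  rewrite lt_def mun0 muE -(rmorph0 (real_complex R)) lecR sumr_ge0// => j _.
  exact: pulled_ge0.
have : {ae m, forall x, forall j, j \in index_enum 'I_n -> forall Q',
    Q' \in fset_set (G j) -> P `<=` Q' -> P x -> 0 < b P Q' x}.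
  apply: ae_all_seq => j _; apply: ae_all_seq => Q'.
  rewrite (mem_level gG) => /asboolP GQ'.
  have [PQ'|nPQ'] := pselect (P `<=` Q'); last exact: nearW.
  have [_ bP] := hpos GQ' (conj WP PQ' : inside W Q' k P).
  by apply: filterS bP => x bx _; exact: bx.
apply: filterS => x bx Px; rewrite -(pmulr_rgt0 _ mu0) deltaE.
have term_ge0 (j : 'I_n) Q' : Q' \in fset_set (G j) -> `[< P `<=` Q' >] ->
    0 <= c Q' * sc P Q' * b P Q' x.
  move=> GQ' /asboolP PQ'; have b0 := bx j (mem_index_enum j) _ GQ' PQ' Px.
  rewrite (mem_level gG) in GQ'; move/asboolP in GQ'.
  have [sc0 _] := hpos GQ' (conj WP PQ' : inside W Q' k P).
  by rewrite mulr_ge0 ?(ltW b0)// mulr_ge0// (c0 _ _ GQ').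
have Qi : Q \in fset_set (G (Ordinal ni)) by rewrite (mem_level gG); exact/asboolP.
have PQb : `[< P `<=` Q >] by apply/asboolP; exact: PQ.2.
apply: (@lt_le_trans _ _ (c Q * sc P Q * b P Q x)).
  have b0 : 0 < b P Q x := bx (Ordinal ni) (mem_index_enum _) Q Qi PQ.2 Px.
  by rewrite mulr_gt0// mulr_gt0// lt_def cQ (c0 _ _ GQ).
apply: le_trans (term_le_sum (F := fun Q => c Q * sc P Q * b P Q x)
  (term_ge0 (Ordinal ni)) Qi PQb) _.
apply: (term_le_sum (F := fun j : 'I_n =>
  \sum_(Q <- fset_set (G j) | `[< P `<=` Q >]) c Q * sc P Q * b P Q x)) => //.
  by move=> j _ _; apply: sum_ge0_in; exact: term_ge0.
exact: mem_index_enum.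
Qed.

End positivity.

End consequences.

(** * Inclusion of the spaces *)

Lemma besov_norm_ge0 {d : measure_display} {T : measurableType d} {R : realType}
    (m : {measure set T -> \bar R}) p q P A (g : T -> R[i]) :
  (0 <= besov_norm m p q P A g)%E.
Proof.
by apply: le_ereal_inf_tmp => _ [c [a [_ ->]]]; exact: lq_cost_ge0.
Qed.

Section inclusion.
Context {d : measure_display} {T : measurableType d} {R : realType}.
Variable m : {measure set T -> \bar R}.
Hypothesis mfin : (m setT < +oo)%E.
Variables (s p : R) (q : \bar R).
Hypothesis s0 : 0 < s.
Hypothesis p0 : 0 < p.
Hypothesis q0 : (0 < q)%E.
Variables (W G : nat -> set (set T)).
Hypothesis gW : is_grid m W.
Hypothesis W1 : G1 (R := R) W.
Hypothesis W2 : G2 m s p q W.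
Hypothesis gG : is_grid m G.
Hypothesis G1G : G1 (R := R) G.
Variables (u2 : \bar R) (A2 : @atom_class d T R).
Hypothesis u21 : (1 <= u2)%E.
Hypothesis aA2 : is_atom_class m W s p u2 A2.
Variables (kk : nat -> nat) (alpha A B lambda C0 : R).
Hypothesis alpha0 : 0 < alpha.
Hypothesis hkk : forall i, alpha * i%:R + A <= (kk i)%:R <= alpha * i%:R + B.
Hypothesis lambda01 : 0 < lambda < 1.
Hypothesis C00 : 0 <= C0.
Variables (A1 : @atom_class d T R).
Hypothesis hA : forall i Q, G i Q -> forall a, atoms A1 Q a ->
  exists (sigma : set T -> R[i]) (beta : set T -> T -> R[i]),
    transmutes m p q W A2 kk lambda C0 i Q sigma beta a.

Local Notation K := (Kconst G p q alpha A B lambda C0).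

(** With the given atoms as the h_Q, the construction yields a limit [g] that agrees with [phi]
    almost everywhere by uniqueness of limits, so the representation of [g] also represents
    [phi]. *)
Lemma transmute_representation c a phi :
  is_representation m p q A1 G c a phi ->
  exists mu delta, is_representation m p q A2 W mu delta phi /\
    (cost W p q mu <= K * cost G p q c)%E.
Proof.
move=> rep; have [mphi _] := rep_Lp rep.
have [F FP] : {F : set T -> (set T -> R[i]) * (set T -> T -> R[i]) &
    forall Q i, G i Q -> transmutes m p q W A2 kk lambda C0 i Q (F Q).1 (F Q).2 (a Q)}.
  apply: (@choice _ _ (fun Q F => forall i, G i Q ->
    transmutes m p q W A2 kk lambda C0 i Q F.1 F.2 (a Q))) => Q.
  have [[i GQ]|nG] := pselect (exists i, G i Q); last first.
    by exists (fun=> 0, fun=> fun=> 0) => i GQ; case: nG; exists i.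
  have [sigma [beta H]] := hA GQ (rep_atoms rep GQ).
  by exists (sigma, beta) => j /(grid_distinct gG GQ) <-.
have [g [mu [delta [[Sg _ _ _ _] repg costmu _]]]] :=
  transmute_exists mfin s0 p0 q0 gW W1 W2 gG G1G u21 aA2 alpha0 hkk lambda01 C00
    (sc := fun P Q => (F Q).1 P) (b := fun P Q => (F Q).2 P) (h := a)
    (fun i Q GQ => FP Q i GQ) (rep_cost rep).
have [mg _] := rep_Lp repg.
have ma i Q : G i Q -> cmeasurable (a Q).
  by move=> /FP[ra _ _]; case: (rep_Lp ra).
have mlG n : cmeasurable (fun x => \sum_(k < n) level_sum G c a k x).
  apply: cmeasurable_sum => k; apply: level_sum_cmeasurable; first exact: grid_finite gG k.
  by move=> Q; exact: ma.
have mlW n : cmeasurable (fun x => \sum_(k < n) level_sum W mu delta k x).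
  apply: cmeasurable_sum => k; apply: level_sum_cmeasurable; first exact: grid_finite gW k.
  by move=> P WP; exact: (atom_cmeasurable aA2 WP (rep_atoms repg WP)).
(* The construction sums over [i <= N], one level more than the partial sums in [rep_cvg]; shifting
   the index reconciles them. *)
have Sphi : Lp_cvg m p%:E (fun n x => \sum_(k < n.+1) level_sum G c a k x) phi.
  have := rep_cvg rep; rewrite /Lp_cvg.
  by rewrite -(cvg_shiftS (fun n => cnorm m p%:E
    (fun x => \sum_(k < n) level_sum G c a k x - phi x))).
have gphi : qnorm m p (fun x => g x - phi x) = 0%E.
  exact: (Lp_cvg_unique p0 (fun n => mlG n.+1) mg mphi Sg Sphi).
exists mu, delta; split; last exact: costmu.
case: repg => Lg ag absg costg cvgg; apply: IsRepresentation.
- exact: rep_Lp rep.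
- exact: ag.
- exact: absg.
- exact: costg.
- exact: (Lp_cvg_eq p0 mlW mg mphi cvgg gphi).
Qed.

Lemma besov_norm_transmute phi : besov m p q G A1 phi ->
  (besov_norm m p q W A2 phi <= K * besov_norm m p q G A1 phi)%E.
Proof.
move=> [c0 [a0 rep0]].
have [r [K0 [C1 [_ _ _ [K00 KE _ _]]]]] :=
  Kconst_bound p0 q0 gG G1G alpha0 hkk lambda01 C00.
have H c a : is_representation m p q A1 G c a phi ->
    (besov_norm m p q W A2 phi <= K0%:E * cost G p q c)%E.
  move=> /transmute_representation[mu [delta [repW cW]]].
  rewrite -KE; apply: le_trans cW; apply: ereal_inf_lbound.
  by exists mu, delta.
(* A positive factor commutes with the infimum over representations; if the constant is zero, a
   single representation already gives norm zero. *)
rewrite KE; move: K00; rewrite le_eqVlt => /predU1P[K0E|Kpos].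
  by have := H _ _ rep0; rewrite -K0E !mul0e.
rewrite /besov_norm -ereal_inf_pZl//; apply: le_ereal_inf_tmp => _ [_ [c [a [rep ->]]] <-].
exact: H rep.
Qed.

Lemma besov_transmute : besov m p q G A1 `<=` besov m p q W A2.
Proof.
move=> phi [c [a /transmute_representation[mu [delta [repW _]]]]].
by exists mu, delta.
Qed.

(** The infimum over an empty set is +oo, so a small norm forces a representation to exist; this
    makes the norm inequality available for the late terms of the sequence. *)
Lemma besov_norm_cvg_transmute (f : nat -> T -> R[i]) :
  (fun n => besov_norm m p q G A1 (f n)) @ \oo --> 0%E ->
  (fun n => besov_norm m p q W A2 (f n)) @ \oo --> 0%E.
Proof.
have [r [K0 [C1 [_ _ _ [K00 KE _ _]]]]] :=
  Kconst_bound p0 q0 gG G1G alpha0 hkk lambda01 C00.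
move=> /(cvge0P (fun n => besov_norm_ge0 m p q G A1 (f n))) fc.
apply/cvge0P => [n|e e0]; first exact: besov_norm_ge0.
have K1 : 0 < K0 + 1 by rewrite ltr_wpDl.
have := fc (e / (K0 + 1)) (divr_gt0 e0 K1); apply: filterS => n fn.
have [|_ [c [a [rep _]]] _] := @ereal_inf_lt R
    [set z | exists c a, is_representation m p q A1 G c a (f n) /\ z = cost G p q c] +oo%E.
  by apply: le_lt_trans fn _; exact: ltry.
have bn : besov m p q G A1 (f n) by exists c, a.
apply: le_trans (besov_norm_transmute bn) _; rewrite KE.
apply: (@le_trans _ _ (K0%:E * (e / (K0 + 1))%:E)%E).
  by apply: lee_wpmul2l; rewrite ?lee_fin.
rewrite -EFinM lee_fin mulrCA ler_piMr ?(ltW e0)//.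
by rewrite ler_pdivrMr// mul1r lerDl.
Qed.

End inclusion.
Theorem proposition8p1 (R : realType) (d : measure_display)
    (T : measurableType d) (m : {finite_measure set T -> \bar R})
    (s p : R) (q : \bar R) (hs : 0 < s) (hp : 0 < p) (hq : (0 < q)%E)
    (* (I) *)
    (W G : nat -> set (set T))
    (hW : is_grid m W) (hW1 : G1 (R := R) W) (hW2 : G2 m s p q W)
    (hG : is_grid m G) (hG1 : G1 (R := R) G) (hG2 : G2 m s p q G)
    (u2 : \bar R) (hu2 : (1 <= u2)%E) (A2 : @atom_class d T R)
    (hA2 : is_atom_class m W s p u2 A2)
    (* (II) *)
    (kk : nat -> nat) (alpha A B : R) (halpha : 0 < alpha)
    (hkk : forall i, alpha * i%:R + A <= (kk i)%:R <= alpha * i%:R + B)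
    (* (III) *)
    (lambda C0 : R) (hlambda : 0 < lambda < 1) (hC0 : 0 <= C0) :
  let K := Kconst G p q alpha A B lambda C0 in
  (forall (sc : set T -> set T -> R[i]) (b : set T -> set T -> T -> R[i])
      (h : set T -> T -> R[i]),
    (forall i Q, G i Q ->
      transmutes m p q W A2 kk lambda C0 i Q (sc^~ Q) (b^~ Q) (h Q)) ->
    (* A *)
    (forall c : set T -> R[i], (cost G p q c < +oo)%E ->
      exists g mu delta, transmuted m p q G W A2 K sc h c g mu delta) /\
    (* B *)
    ((forall i Q k P, G i Q -> inside W Q k P ->
        0 <= sc P Q /\ {ae m, forall x, P x -> 0 < b P Q x}) ->
     forall c : set T -> R[i], (cost G p q c < +oo)%E ->
      exists g mu delta,
        [/\ transmuted m p q G W A2 K sc h c g mu delta,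
            forall k P, used G W sc k P -> mu P != 0 ->
              ~ {ae m, forall x, P x -> delta P x = 0} ->
              exists i Q, [/\ G i Q, inside W Q k P, c Q != 0, 0 < sc P Q
                & {ae m, forall x, P x -> h Q x != 0}]
          & (forall i Q, G i Q -> 0 <= c Q) ->
            forall k P, used G W sc k P -> mu P != 0 ->
              {ae m, forall x, P x -> 0 < delta P x}])) /\
  (* C *)
  (forall (u1 : \bar R) (A1 : @atom_class d T R), (1 <= u1)%E ->
    is_atom_class m G s p u1 A1 ->
    (forall i Q, G i Q -> forall a, atoms A1 Q a ->
      exists (sigma : set T -> R[i]) (beta : set T -> T -> R[i]),
        transmutes m p q W A2 kk lambda C0 i Q sigma beta a) ->
    [/\ besov m p q G A1 `<=` besov m p q W A2,
        forall (phin : nat -> T -> R[i]) (phi : T -> R[i]),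
          (forall n, besov m p q G A1 (phin n)) -> besov m p q G A1 phi ->
          besov_norm m p q G A1 (fun x => phin n x - phi x)
            @[n --> \oo] --> 0%E ->
          besov_norm m p q W A2 (fun x => phin n x - phi x)
            @[n --> \oo] --> 0%E
      & forall phi, besov m p q G A1 phi ->
          (besov_norm m p q W A2 phi <= K * besov_norm m p q G A1 phi)%E]).
Proof.
have mfin : (m setT < +oo)%E by rewrite ltey_eq fin_num_measure.
move=> K; split.
  move=> sc b h htr.
  (* One construction serves both parts, so the representation in B is the one built for A. *)
  have main c cfin := transmute_exists mfin hs hp hq hW hW1 hW2 hG hG1 hu2 hA2
    halpha hkk hlambda hC0 htr (c := c) cfin.
  split=> [c cfin|hpos c cfin].
    by have [g [mu [delta [H _ _ _]]]] := main c cfin; exists g, mu, delta.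
  have [g [mu [delta [H _ _ spec]]]] := main c cfin; exists g, mu, delta.
  have pos k P : used G W sc k P -> mu P != 0 ->
      (exists i Q, [/\ G i Q, inside W Q k P, c Q != 0, 0 < sc P Q
        & {ae m, forall x, P x -> h Q x != 0}]) /\
      ((forall i Q, G i Q -> 0 <= c Q) -> {ae m, forall x, P x -> 0 < delta P x}).
    move=> /used_W WP muP; have [n [deltaE muE]] := spec k P WP.
    exact: (transmuted_positive hp hW hG hA2 htr hpos WP deltaE muE muP).
  split; first exact: H.
    by move=> k P uP muP _; have [] := pos k P uP muP.
  by move=> c0 k P uP muP; have [_] := pos k P uP muP; apply.
move=> u1 A1 hu1 hA1 hA.
split.
- exact: (besov_transmute mfin hs hp hq hW hW1 hW2 hG hG1 hu2 hA2 halpha hkk hlambda hC0 hA).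
- move=> phin phi _ _.
  exact: (besov_norm_cvg_transmute mfin hs hp hq hW hW1 hW2 hG hG1 hu2 hA2 halpha hkk
    hlambda hC0 hA).
- move=> phi.
  exact: (besov_norm_transmute mfin hs hp hq hW hW1 hW2 hG hG1 hu2 hA2 halpha hkk
    hlambda hC0 hA).
Qed.
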